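(* Let $\phi:\mathscr K^2\to\mathbb Z$ be a function. Then $\phi$ is a monotone $\sigma$-continuous valuation if and only if there exist $N^+,N^-\in\mathbb N\cup\{0,\infty\}$ and two locally finite families $(C_n^+)_{n=1}^{N^+}$ and $(C_n^-)_{n=1}^{N^-}$ of nonempty closed convex subsets of $\mathbb R^2$, with $(C_n^-)$ admissible with respect to $(C_n^+)$, such that for every $K\in\mathscr K^2$ $$\phi(K)=\sum_{n=1}^{N^+}\chi(K\cap C_n^+)-\sum_{n=1}^{N^-}\chi(K\cap C_n^-).$$ Moreover, the families are not uniquely determined: two such pairs of families $(C_n^+)_{n=1}^{N^+},(C_n^-)_{n=1}^{N^-}$ and $(\widetilde C_n^+)_{n=1}^{\widetilde N^+},(\widetilde C_n^-)_{n=1}^{\widetilde N^-}$ define the same valuation through this formula if and only if $$\sum_{n=1}^{N^+}\mathbf 1_{C_n^+}(x)-\sum_{n=1}^{N^-}\mathbf 1_{C_n^-}(x)=\sum_{n=1}^{\widetilde N^+}\mathbf 1_{\widetilde C_n^+}(x)-\sum_{n=1}^{\widetilde N^-}\mathbf 1_{\widetilde C_n^-}(x)\quad\text{for all }x\in\mathbb R^2.$$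
   Context: $\mathscr K^2$ is the family of all compact convex subsets of $\mathbb R^2$, including the empty set. A valuation is a map $\phi$ on $\mathscr K^2$ with $\phi(\emptyset)=0$ and $\phi(K\cup L)+\phi(K\cap L)=\phi(K)+\phi(L)$ for all $K,L\in\mathscr K^2$ such that $K\cup L$ is convex. It is monotone if $\phi(K)\le\phi(L)$ whenever $K\subset L$. It is $\sigma$-continuous if $\phi(K_n)\to\phi(K)$ for every sequence $(K_n)$ in $\mathscr K^2$ with $K_n\downarrow K$ (decreasing with intersection $K$). The Euler characteristic is $\chi(K)=1$ if $K\neq\emptyset$ and $\chi(\emptyset)=0$; this convention is used for all convex sets. A family of $N\in\mathbb N\cup\{0,\infty\}$ closed convex sets $C_n$ (repetitions allowed) is locally finite if every $K\in\mathscr K^2$ has nonempty intersection with only finitely many of them. For a closed convex set $C\subset\mathbb R^2$ and $x\in C$, the normal cone is $\mathcal N_C(x)=\{u\in\mathbb R^2:\langle u,y-x\rangle\le 0\text{ for all }y\in C\}$; for $x\notin C$ set $\mathcal N_C(x)=\emptyset$. A locally finite family $(C_n^-)_{n=1}^{N^-}$ is admissible with respect to a locally finite family $(C_n^+)_{n=1}^{N^+}$ if $$\sum_{n=1}^{N^-}\mathbf 1_{\mathcal N_{C_n^-}(x)}(u)\le\sum_{n=1}^{N^+}\mathbf 1_{\mathcal N_{C_n^+}(x)}(u)\quad\text{for all }x,u\in\mathbb R^2.$$ *)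

(* Defs.v *)
From mathcomp Require Import all_boot all_order all_algebra.
From mathcomp Require Import all_classical all_reals all_analysis.
Import Order.TTheory GRing.Theory Num.Theory.
Import numFieldNormedType.Exports.

Set Implicit Arguments.
Unset Strict Implicit.
Unset Printing Implicit Defensive.

Local Open Scope classical_set_scope.
Local Open Scope ring_scope.

Definition dotp (R : realType) (u v : 'rV[R]_2) : R :=
  \sum_(i < 2) u ord0 i * v ord0 i.

Record K2 (R : realType) := MkK2 {
  body :> set 'rV[R]_2;
  body_compact : compact body;
  body_convex : convex_set body }.

Lemma convex_set0 (R : realType) : convex_set (set0 : set 'rV[R]_2).
Proof. by move=> x y l; rewrite in_set0. Qed.

Definition K2_empty (R : realType) : K2 R :=
  MkK2 (@compact0 _) (@convex_set0 R).

Lemma K2_compactI (R : realType) (K L : K2 R) : compact (K `&` L).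
Proof.
apply: compact_closedI; first exact: body_compact.
by apply: compact_closed; [exact: norm_hausdorff | exact: body_compact].
Qed.

Lemma K2_convexI (R : realType) (K L : K2 R) : convex_set (K `&` L).
Proof.
move=> x y l; rewrite !in_setI => /andP[Kx Lx] /andP[Ky Ly].
by apply/andP; split; exact: body_convex.
Qed.

Definition K2_inter (R : realType) (K L : K2 R) : K2 R :=
  MkK2 (@K2_compactI R K L) (@K2_convexI R K L).

(* The union of two compact sets is compact, so [U] below exists exactly when
   the union of [K] and [L] is convex. *)
Definition K2_valuation (R : realType) (phi : K2 R -> int) : Prop :=
  phi (K2_empty R) = 0 /\
  forall K L U : K2 R, (U : set _) = K `|` L ->
    phi U + phi (K2_inter K L) = phi K + phi L.

Definition K2_monotone (R : realType) (phi : K2 R -> int) : Prop :=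
  forall K L : K2 R, K `<=` L -> phi K <= phi L.

(* The integer values are embedded in the reals to speak of convergence. *)
Definition K2_sigma_continuous (R : realType) (phi : K2 R -> int) : Prop :=
  forall (A : nat -> K2 R) (K : K2 R),
    (forall n, A n.+1 `<=` A n) -> \bigcap_n A n = K ->
    (phi (A n))%:~R @[n --> \oo] --> ((phi K)%:~R : R).

Definition chi (R : realType) (A : set 'rV[R]_2) : int :=
  if A == set0 then 0 else 1.

(* A sequence of sets of length [fam_len], [None] standing for an infinite
   sequence; the terms are numbered from 0, and those of rank at least [fam_len]
   are irrelevant. *)
Record set_family (R : realType) := SetFamily {
  fam_len : option nat;
  fam_set :> nat -> set 'rV[R]_2 }.

Definition indices (R : realType) (C : set_family R) : set nat :=
  if fam_len C is Some N then [set n | (n < N)%N] else setT.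

Definition nonempty_closed_convex (R : realType) (C : set_family R) : Prop :=
  forall n, indices C n -> [/\ C n !=set0, closed (C n) & convex_set (C n)].

Definition locally_finite (R : realType) (C : set_family R) : Prop :=
  forall K : K2 R,
    finite_set [set n | indices C n /\ (K `&` C n) !=set0].

Definition normal_cone (R : realType) (C : set 'rV[R]_2) (x : 'rV[R]_2) :
    set 'rV[R]_2 :=
  [set u | C x /\ forall y, C y -> dotp u (y - x) <= 0].

(* The sums over [indices] below are finitely supported sums: when the
   families are locally finite, all but finitely many terms vanish. *)
Definition admissible (R : realType) (Cm Cp : set_family R) : Prop :=
  forall x u : 'rV[R]_2,
    \sum_(n \in indices Cm) (\1_(normal_cone (Cm n) x) u : int) <=
    \sum_(n \in indices Cp) (\1_(normal_cone (Cp n) x) u : int).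

Definition admissible_pair (R : realType) (Cp Cm : set_family R) : Prop :=
  [/\ nonempty_closed_convex Cp, nonempty_closed_convex Cm,
      locally_finite Cp, locally_finite Cm & admissible Cm Cp].

Definition pair_valuation (R : realType) (Cp Cm : set_family R) (K : K2 R) : int :=
  \sum_(n \in indices Cp) chi (K `&` Cp n) -
  \sum_(n \in indices Cm) chi (K `&` Cm n).

Definition pair_indicator (R : realType) (Cp Cm : set_family R) (x : 'rV[R]_2) :
    int :=
  \sum_(n \in indices Cp) (\1_(Cp n) x : int) -
  \sum_(n \in indices Cm) (\1_(Cm n) x : int).

Definition reordering (R : realType) (C D : set_family R) : Prop :=
  exists f : nat -> nat, set_bij (indices C) (indices D) f /\
    forall n, indices C n -> C n = D (f n).

(* Main.v *)
(* Existence. Bisection reduces the claim that the point values [phi {x}] are locally an integer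
   combination of indicators of compact convex sets to one-sided strips along a vertical line in
   which the value of every vertical section is a constant [c]. There, the value of the upward
   vertical segment from a point counts how many of [c] "tops" lie above it. Give each top its
   left slope as a tangent line, and link two tops at different times when each lies below the
   tangent line of the other. Monotonicity shows that two times carry no antichain of more than
   [c] tops, so Hall's theorem matches the tops at any two times; as the relation is transitive,
   a compactness argument arranges the tops into [c] concave functions, whose hypographs are the
   required convex sets. Half-open unit cells glue the local representations, and a valuation
   that is sigma-continuous is determined by its point values (bisect twice), which also settles
   when two pairs of families define the same valuation.

   Monotonicity of [pair_valuation]. For a strongly convex smooth [F] separating the sets meeting
   [K], those meeting [L] only, and the others, by the minimum of [F] on them, the sets of the
   second kind are counted by the normal cones containing [- grad F] at the minimisers, where
   admissibility applies. Conversely, admissibility at [(x, u)] is monotonicity for a small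
   square around [x] and the part of it slightly shifted in the direction [u]. *)
From HB Require Import structures.
Require Import Defs.
From mathcomp Require Import all_boot all_order all_algebra.
From mathcomp Require Import all_classical all_reals all_analysis.
From mathcomp Require Import finmap zify ring lra.
Import Order.TTheory GRing.Theory Num.Theory.
Import numFieldNormedType.Exports.

Set Implicit Arguments.
Unset Strict Implicit.
Unset Printing Implicit Defensive.

Local Open Scope classical_set_scope.
Local Open Scope ring_scope.

(** * Tops of a valuation over a strip of constant value *)

(** Strips are one-sided because the value of a vertical section may jump at a single abscissa: to
    the right of [t] these values are nonincreasing near [t], hence constant close to it, but the
    section at [t] itself may have a larger value.

    Tops cannot be matched by rank, since the concave functions sought may cross, and the [j]-th
    largest of several concave functions need not be concave. Concavity itself is a condition on
    three times; fixing a slope for each top turns it into a relation between two times that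
    composes. The slope is read off on the left of [t] only. That it also governs the tops on the
    right is where the valuation property on two-dimensional trapezoids enters.

    The construction gives no control on normal cones. Admissibility is recovered afterwards from
    monotonicity, for any locally finite families that represent the valuation. Non-uniqueness comes
    from adjoining one and the same set to both families. *)

Section Bent.
Variable R : realType.
Implicit Types (l : R -> R).

Definition line (y s t : R) : R -> R := fun u => y + s * (u - t).

(** Two affine pieces suffice: the regions used are bounded below by one line, or by the two lines
    that cut off a corner in [tip_right]. Such functions are convex, so the regions above them are
    convex. *)
Definition bent l := exists k : (R * R) * (R * R),
  forall t, l t = Num.max (k.1.1 + k.1.2 * t) (k.2.1 + k.2.2 * t).

Lemma bent_line y s t : bent (line y s t).
Proof.
by exists ((y - s * t, s), (y - s * t, s)) => u; rewrite maxxx /= /line; ring.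
Qed.

Lemma bent_cst y : bent (fun=> y).
Proof. by exists ((y, 0), (y, 0)) => u; rewrite maxxx mul0r addr0. Qed.

Lemma bent_max y s t y' s' t' :
  bent (fun u => Num.max (line y s t u) (line y' s' t' u)).
Proof.
exists ((y - s * t, s), (y' - s' * t', s')) => u /=.
by congr Num.max; rewrite /line; ring.
Qed.

Lemma bent_opp l : bent l -> bent (fun u => l (- u)).
Proof.
case=> -[[a b] [a' b']] /= h; exists ((a, - b), (a', - b')) => u /=.
by rewrite h !mulrN !mulNr.
Qed.

(* [w p q l] stands for the value of a monotone valuation on the part of the strip
   [p <= x <= q] lying above the graph of [l] and below the height [M]; by [tops_strip] this
   value does not depend on the strip when [l] is the bottom [m]. *)
Record tops (w : R -> R -> (R -> R) -> int) (m M al be : R) (c : nat) : Prop :=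
  Tops {
    tops_split : forall l p r q, bent l -> p <= r -> r <= q ->
      w p q l = w p r l + w r q l - w r r l;
    tops_mono : forall l l' p q p' q', bent l -> bent l' -> p <= p' -> q' <= q ->
      (forall t, p' <= t -> t <= q' -> l t <= l' t) -> w p' q' l' <= w p q l;
    tops_loc : forall t y, exists2 d, 0 < d &
      w (t - d) (t + d) (fun=> y - d) = w t t (fun=> y);
    tops_strip : forall p q, al < p -> p <= q -> q < be -> w p q (fun=> m) = c%:Z;
    tops_top : forall t y, M < y -> w t t (fun=> y) = 0 }.

(** Reflection of the horizontal axis. It yields [star_left] and [tip_left] from their right-hand
    twins; the slopes are one-sided and are treated separately. *)
Lemma tops_rev w m M al be c : tops w m M al be c ->
  tops (fun p q l => w (- q) (- p) (fun u => l (- u))) m M (- be) (- al) c.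
Proof.
case=> h1 h2 h3 h4 h5; split.
- move=> l p r q bl pr rq; rewrite (h1 _ (- q) (- r) (- p)) ?lerN2//; last exact: bent_opp.
  by rewrite (addrC (w (- q) _ _)).
- move=> l l' p q p' q' bl bl' pp qq ll; apply: h2; rewrite ?lerN2//.
  + exact: bent_opp.
  + exact: bent_opp.
  + by move=> t t1 t2; apply: ll; lra.
- move=> t y; have [d d0 hd] := h3 (- t) y; exists d => //.
  by rewrite -hd; congr (w _ _ _); ring.
- by move=> p q p1 pq q1; apply: h4; lra.
- by move=> t y; apply: h5.
Qed.

End Bent.

Section Tops.
Variables (R : realType) (w : R -> R -> (R -> R) -> int).
Variables (m M al be : R) (c : nat).
Hypothesis wT : tops w m M al be c.

Definition top_count (t y : R) : int := w t t (fun=> y).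
Local Notation n := top_count.

Lemma w_at l t : bent l -> w t t l = n t (l t).
Proof.
move=> bl; have bc := bent_cst (l t); apply/eqP; rewrite eq_le.
apply/andP; split; apply: (tops_mono wT) => // u u1 u2;
  by have -> : u = t by apply/eqP; rewrite eq_le u1 u2.
Qed.

Lemma top_count_le t y y' : y <= y' -> n t y' <= n t y.
Proof.
by move=> yy; apply: (tops_mono wT) => //; exact: bent_cst.
Qed.

Lemma top_count_m t : al < t -> t < be -> n t m = c%:Z.
Proof. by move=> h1 h2; apply: (tops_strip wT). Qed.

(** Upper semicontinuity for all curves near [(t, y)]: the bound is inclusion in the region of
    [tops_loc], and equality holds once the strip contains the segment above [(t, y)]. *)
Lemma w_local t y : al < t -> t < be -> exists d, [/\ 0 < d, al < t - d, t + d < be,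
  (forall p q l, bent l -> t - d <= p -> q <= t + d ->
    (forall u, p <= u -> u <= q -> y - d <= l u) -> w p q l <= n t y) &
  (forall p q l, bent l -> t - d <= p -> p <= t -> t <= q -> q <= t + d ->
    (forall u, p <= u -> u <= q -> y - d <= l u) -> l t <= y -> w p q l = n t y)].
Proof.
move=> h1 h2; have [d0 d00 hd0] := tops_loc wT t y.
pose d := Num.min d0 (Num.min ((t - al) / 2) ((be - t) / 2)).
have [le1 [le2 le3]] : d <= d0 /\ d <= (t - al) / 2 /\ d <= (be - t) / 2.
  by rewrite /d !ge_min !lexx !orbT.
have dp : 0 < d by rewrite /d !lt_min d00; apply/andP; split => //; apply/andP; split; lra.
have loc : forall p q l, bent l -> t - d <= p -> q <= t + d ->
    (forall u, p <= u -> u <= q -> y - d <= l u) -> w p q l <= n t y.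
  move=> p q l bl pd qd ld; rewrite -[n t y]hd0.
  apply: (tops_mono wT) => //; [exact: bent_cst|lra|lra|].
  by move=> u u1 u2; have := ld u u1 u2; lra.
exists d; split => //; [lra|lra|].
move=> p q l bl pd pt tq qd ld lt; apply/eqP; rewrite eq_le loc//=.
by apply: (tops_mono wT) => //; [exact: bent_cst|move=> u u1 u2;
  have -> : u = t by apply/eqP; rewrite eq_le u1 u2].
Qed.

(* On the line from [(t, y)] down to the bottom point [(q, m)], the trapezoids
   over [[u, q]] have the full value [c], whence monotonicity along the line. *)
Lemma star_right t y q u : al < t -> q < be -> m <= y -> t <= u -> u <= q -> t < q ->
  n t y <= n u (y - (y - m) / (q - t) * (u - t)).
Proof.
move=> at_ qb my tu uq tq; pose l := line y (- ((y - m) / (q - t))) t.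
have bl : bent l by exact: bent_line.
have lq : l q = m by rewrite /l /line; field; rewrite subr_eq0 gt_eqF.
have lt : l t = y by rewrite /l /line subrr mulr0 addr0.
have lge v : v <= q -> m <= l v.
  move=> vq; rewrite -lq /l /line lerD2l !mulNr lerN2 ler_wpM2l//; last by lra.
  by rewrite divr_ge0// subr_ge0// ltW.
have full v : t <= v -> v <= q -> w v q l = c%:Z.
  move=> tv vq; apply/eqP; rewrite eq_le; apply/andP; split.
    rewrite -(tops_strip wT (p := v) (q := q)) //; last lra.
    by apply: (tops_mono wT) => //; [exact: bent_cst|move=> x _; exact: lge].
  rewrite -(top_count_m (t := q)) //; last lra.
  have -> : n q m = w q q l by rewrite w_at// lq.
  by apply: (tops_mono wT).
(* With value [c] over both [[t, q]] and [[u, q]], the split at [u] leaves [w t u l = n u (l u)]. *)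
have := tops_split wT bl tu uq; rewrite full ?lexx//; last exact: ltW.
rewrite full// w_at//.
have : n t y <= w t u l.
  rewrite -{1}lt -w_at//; apply: (tops_mono wT) => //.
have -> : l u = y - (y - m) / (q - t) * (u - t) by rewrite /l /line mulNr.
lia.
Qed.

End Tops.

(** * Integer step functions of the height and their jumps *)

Section Jump.
Variables (R : realType) (n : R -> int) (m M : R) (c : nat).
Hypotheses (n_anti : forall y y', y <= y' -> n y' <= n y) (n_m : n m = c%:Z).
Hypotheses (n_top : forall y, M < y -> n y = 0).
Hypothesis n_loc : forall y, exists2 d, 0 < d & n (y - d) <= n y.

Definition jump (j : nat) : R := sup [set y | m <= y /\ j.+1%:Z <= n y].

(** [n_loc] makes the supremum attained, so the superlevel sets are closed half-lines. Heights below
    [m] are below the jump because [m] itself belongs to the set. *)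
Lemma le_jump j y : (j < c)%N -> (y <= jump j) = (j.+1%:Z <= n y).
Proof.
move=> jc; set S := [set y | m <= y /\ j.+1%:Z <= n y].
have Sm : S m by split => //; rewrite n_m; lia.
have hS : has_sup S.
  split; first by exists m.
  by exists M => z [_ hz]; rewrite leNgt; apply/negP => Mz; move: hz; rewrite n_top.
have jumpS : j.+1%:Z <= n (jump j).
  have [d d0 hd] := n_loc (jump j).
  have [z [mz nz] hz] := sup_adherent d0 hS.
  by apply: (le_trans nz); apply: le_trans hd; apply: n_anti; exact: ltW.
apply/idP/idP => [yt|ny]; first by apply: (le_trans jumpS); exact: n_anti.
have [my|ym] := leP m y; first by apply: ub_le_sup; [case: hS|split].
by apply: (le_trans (ltW ym)); apply: ub_le_sup; [case: hS|].
Qed.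

Lemma card_jump y : m <= y -> n y = #|[set j : 'I_c | y <= jump j]%SET|%:Z.
Proof.
move=> my; have : 0 <= n y.
  rewrite -(n_top (y := Num.max (M + 1) (y + 1))) ?lt_max ?ltrDl ?ltr01//.
  by apply: n_anti; rewrite le_max lerDl ler01 orbT.
have : n y <= c%:Z by rewrite -n_m; exact: n_anti.
case E : (n y) => [k|//] kc _; congr Posz.
have inj : injective (widen_ord (n := k) (m := c) kc).
  by move=> x z /(congr1 val) /= xz; apply: val_inj.
rewrite -[k in LHS]card_ord -(card_codom inj).
apply: eq_card => j; rewrite inE le_jump// E.
apply/codomP/idP => [[x ->] /=|jk]; first by have := ltn_ord x; lia.
have jk' : (j < k)%N by lia.
by exists (Ordinal jk'); apply: val_inj.
Qed.

End Jump.

Section TopsAndSlopes.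
Variables (R : realType) (w : R -> R -> (R -> R) -> int).
Variables (m M al be : R) (c : nat).
Hypothesis wT : tops w m M al be c.
Local Notation n := (top_count w).

Lemma star_left t y p u : al < p -> t < be -> m <= y -> p <= u -> u <= t -> p < t ->
  n t y <= n u (y - (y - m) / (t - p) * (t - u)).
Proof.
move=> ap tb my pu ut pt.
have := @star_right _ _ _ _ _ _ _ (tops_rev wT) (- t) y (- p) (- u).
rewrite /top_count !opprK.
have -> : - p + t = t - p by rewrite addrC.
have -> : - u + t = t - u by rewrite addrC.
apply; lra.
Qed.

Definition top (j : nat) (t : R) : R := jump (n t) m j.

Section Top.
Variables (t : R) (at_ : al < t) (tb : t < be).

Lemma top_count_loc y : exists2 d, 0 < d & n t (y - d) <= n t y.
Proof.
have [d [d0 _ _ hd _]] := w_local wT y at_ tb; exists d => //.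
by apply: (hd t t (fun=> y - d)); [exact: bent_cst|lra|lra|].
Qed.

Lemma le_top j y : (j < c)%N -> (y <= top j t) = (j.+1%:Z <= n t y).
Proof.
move=> jc; apply: (@le_jump _ (n t) m M c) => //.
- by move=> z z'; exact: (top_count_le wT).
- exact: (top_count_m wT).
- exact: (tops_top wT).
- exact: top_count_loc.
Qed.

Lemma top_count_top j : (j < c)%N -> j.+1%:Z <= n t (top j t).
Proof. by move=> jc; rewrite -le_top. Qed.

Lemma top_ge j : (j < c)%N -> m <= top j t.
Proof. by move=> jc; rewrite le_top// (top_count_m wT)//; lia. Qed.

Lemma top_le_M j : (j < c)%N -> top j t <= M.
Proof.
move=> jc; rewrite leNgt; apply/negP => h.
by have := le_top (top j t) jc; rewrite lexx /top_count (tops_top wT).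
Qed.

Lemma top_anti i j : (i <= j)%N -> (j < c)%N -> top j t <= top i t.
Proof.
move=> ij jc; rewrite le_top; last exact: leq_ltn_trans jc.
by apply: (@le_trans _ _ j.+1%:Z); [lia|rewrite -le_top].
Qed.

Lemma top_countE y : m <= y -> n t y = #|[set j : 'I_c | y <= top j t]%SET|%:Z.
Proof.
move=> my; apply: (@card_jump _ (n t) m M c) => //.
- by move=> z z'; exact: (top_count_le wT).
- exact: (top_count_m wT).
- exact: (tops_top wT).
- exact: top_count_loc.
Qed.

End Top.

(* The left lower derivative of the [j]-th top at [t]. *)
Definition steep j t : set R := [set s | forall d, 0 < d ->
  exists u, [/\ t - d < u, u < t & line (top j t) s t u < top j u]].
Definition slope j t : R := inf (steep j t).

Lemma steep_up j t s s' : s <= s' -> steep j t s -> steep j t s'.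
Proof.
move=> ss hs d d0; have [u [u1 u2 u3]] := hs d d0; exists u; split => //.
apply: le_lt_trans u3; rewrite /line lerD2l.
by rewrite ler_wnM2r// subr_le0 ltW.
Qed.

(** The difference quotients of a top to the left of [t] are bounded near [t]: [star_left] issued
    from the top at [t] bounds them above, [star_right] issued from the top at a nearby [u] bounds
    them below. *)
Lemma steep_inf j t : al < t -> t < be -> (j < c)%N -> has_inf (steep j t).
Proof.
move=> at_ tb jc.
have my := top_ge at_ tb jc.
split.
  pose p := (al + t) / 2; have [ap pt] : al < p /\ p < t by rewrite /p; lra.
  exists ((top j t - m) / (t - p) + 1) => d d0.
  pose u := Num.max p (t - d / 2).
  have [pu [du ut]] : p <= u /\ t - d / 2 <= u /\ u < t.
    by rewrite /u !le_max gt_max !lexx orbT; split => //; split => //; apply/andP; split; lra.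
  exists u; split => //; first lra.
  have au : al < u by lra.
  have ub : u < be by lra.
  have := le_trans (top_count_top at_ tb jc) (star_left ap tb my pu (ltW ut) pt).
  rewrite -le_top//; apply: lt_le_trans; rewrite /line; set a := _ / _; rewrite !mulrDl mul1r; nra.
pose q := (t + be) / 2; have [tq qb] : t < q /\ q < be by rewrite /q; lra.
exists (- ((M - m) / (q - t))) => s hs.
have [u [u1 u2 u3]] := hs (t - al) ltac:(lra).
have au : al < u by lra.
have ub : u < be by lra.
have := le_trans (top_count_top au ub jc)
  (star_right wT au qb (top_ge au ub jc) (ltW u2) (ltW tq) (lt_trans u2 tq)).
rewrite -le_top// => h1.
have h2 := top_le_M au ub jc.
set x := (M - m) / (q - t); move: h1; set y := _ / _ => h1.
have hy : y * (q - u) = top j u - m by rewrite /y mulfVK// subr_eq0 gt_eqF// (lt_trans u2).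
have hx : x * (q - t) = M - m by rewrite /x mulfVK// subr_eq0 gt_eqF.
rewrite leNgt; apply/negP => sx.
move: u3; rewrite /line => u3.
have x0 : 0 <= x.
  have mu := top_ge au ub jc.
  by rewrite -(@pmulr_lge0 _ (q - t)) ?subr_gt0// hx; lra.
have qu : 0 < q - u by lra.
have yx : y <= x by rewrite -(ler_pM2r qu) hy; nra.
have : y * (t - u) <= x * (t - u) by nra.
nra.
Qed.

Lemma slope_left j t s : al < t -> t < be -> (j < c)%N -> s < slope j t ->
  exists2 d, 0 < d & forall u, t - d < u -> u < t -> top j u < line (top j t) s t u.
Proof.
move=> at_ tb jc ss; pose s' := (s + slope j t) / 2.
have /existsNP[d /not_implyP[d0 hd]] : ~ steep j t s'.
  move=> hs; have : slope j t <= s' by apply: ge_inf => //; case: (steep_inf at_ tb jc).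
  by rewrite /s'; lra.
exists d => // u u1 u2.
have : top j u <= line (top j t) s' t u.
  by rewrite leNgt; apply/negP => h; apply: hd; exists u.
move=> /le_lt_trans; apply; rewrite /line ltrD2l; rewrite ltr_nM2r; last lra.
by rewrite /s'; lra.
Qed.

Lemma slope_steep j t s : al < t -> t < be -> (j < c)%N -> slope j t < s -> steep j t s.
Proof.
move=> at_ tb jc h.
have [|z hz zs] := @inf_lt _ (steep j t) s _ h; first by case: (steep_inf at_ tb jc).
exact: (steep_up (ltW zs)).
Qed.
End TopsAndSlopes.

Section Chord.
Variable R : realType.
Implicit Types t y : R.

Definition chord t y t' y' : R -> R := line y ((y' - y) / (t' - t)) t.

Lemma bent_chord t y t' y' : bent (chord t y t' y').
Proof. exact: bent_line. Qed.

Lemma chord_fst t y t' y' : chord t y t' y' t = y.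
Proof. by rewrite /chord /line subrr mulr0 addr0. Qed.

Lemma chord_snd t y t' y' : t < t' -> chord t y t' y' t' = y'.
Proof. by move=> tt; rewrite /chord /line mulfVK ?subr_eq0 ?gt_eqF//; ring. Qed.

Lemma chord_conv t y t' y' u : t < t' ->
  chord t y t' y' u = y * ((t' - u) / (t' - t)) + y' * ((u - t) / (t' - t)).
Proof. by move=> tt; rewrite /chord /line; field; rewrite subr_eq0 gt_eqF. Qed.

Lemma chord_le t y1 y2 t' z1 z2 u : t < t' -> t <= u -> u <= t' ->
  y1 <= z1 -> y2 <= z2 -> chord t y1 t' y2 u <= chord t z1 t' z2 u.
Proof.
move=> tt tu ut h1 h2; rewrite !chord_conv//.
by apply: lerD; apply: ler_wpM2r => //; apply: divr_ge0; lra.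
Qed.

Lemma chord_snd_line t y t' y' : t < t' ->
  chord t y t' y' = line y' ((y' - y) / (t' - t)) t'.
Proof.
move=> tt; apply/funext => u; rewrite /chord /line; field.
by rewrite subr_eq0 gt_eqF.
Qed.

Lemma card_ord_itv c (A : {set 'I_c}) (a b : nat) :
  (forall i, i \in A -> (a <= i < b)%N) -> (#|A| <= b - a)%N.
Proof.
move=> h; rewrite cardE -(size_map val) -(size_iota a (b - a)).
apply: uniq_leq_size; first by rewrite map_inj_uniq ?enum_uniq//; exact: val_inj.
move=> x /mapP[i]; rewrite mem_enum => /h /andP[h1 h2] ->; rewrite mem_iota h1 subnKC//; exact:
  leq_trans (ltnW h2).
Qed.

Lemma finite_gap (T : finType) (f : T -> R) (a : R) :
  exists2 b, a < b & forall x, a < f x -> b <= f x.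
Proof.
suff [b ab hb] : exists2 b, a < b & forall x, x \in enum T -> a < f x -> b <= f x.
  by exists b => // x; apply: hb; rewrite mem_enum.
move: (enum T) => es; elim: es => [|x es [b ab hb]]; first by exists (a + 1) => //; rewrite ltrDl.
have [afx|fxa] := ltP a (f x).
  exists (Num.min b (f x)); first by rewrite lt_min ab.
  move=> z; rewrite inE => /orP[/eqP ->|zs az]; first by rewrite ge_min lexx orbT.
  by rewrite ge_min hb.
exists b => // z; rewrite inE => /orP[/eqP ->|zs]; last exact: hb.
by rewrite ltNge fxa.
Qed.

End Chord.

Section TopsRight.
Variables (R : realType) (w : R -> R -> (R -> R) -> int).
Variables (m M al be : R) (c : nat).
Hypothesis wT : tops w m M al be c.
Local Notation n := (top_count w).
Local Notation top := (top w m).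
Local Notation slope := (slope w m).

(** A line slightly above [(t, top j t)] and less steep than [s] still passes below the [j]-th top
    at some [v < t], so at least [j.+1] is spent over [[v, t]]. The trapezoid over [[v, u]] has
    value at most [n t (top j t)] and only [k] is shared at [t], which bounds what remains over
    [[t, u]]. *)
Lemma slope_right j t s (k : int) : al < t -> t < be -> (j < c)%N -> slope j t < s ->
  (forall y, top j t < y -> n t y <= k) ->
  exists2 d, 0 < d & forall u, t < u -> u < t + d ->
    n u (line (top j t) s t u) <= n t (top j t) - j.+1%:Z + k.
Proof.
move=> at_ tb jc ss hk; set y1 := top j t in hk *.
have [d [d0 ad db hloc _]] := w_local wT y1 at_ tb.
pose s' := (slope j t + s) / 2.
have [ss1 ss2] : slope j t < s' /\ s' < s by rewrite /s'; lra.
pose r := d / (`|s'| + 1).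
have s'1 : 0 < `|s'| + 1 by have := normr_ge0 s'; lra.
have r0 : 0 < r by apply: divr_gt0.
have rd : r * (`|s'| + 1) = d by rewrite /r mulfVK// gt_eqF.
have rd' : r <= d by have := normr_ge0 s'; nra.
have [v [v1 v2 v3]] := slope_steep wT at_ tb jc ss1 r0.
exists r => // u u1 u2.
(* The line raised by [e] passes strictly above [(t, y1)], but not above the top at [v] nor above
   the line of slope [s] at [u]. *)
pose e := Num.min ((s - s') * (u - t)) (top j v - line y1 s' t v).
have e0 : 0 < e by rewrite /e lt_min subr_gt0 v3 andbT; apply: mulr_gt0; lra.
have [e1 e2] : e <= (s - s') * (u - t) /\ e <= top j v - line y1 s' t v.
  by rewrite /e !ge_min !lexx orbT.
pose l := line (y1 + e) s' t.
have bl : bent l by exact: bent_line.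
have := tops_split wT bl (ltW v2) (ltW u1).
have h0 : w v u l <= n t y1.
  apply: hloc => //; [lra|lra|move=> z z1 z2; rewrite /l /line].
  have : `|s' * (z - t)| <= `|s'| * r.
    by rewrite normrM ler_wpM2l// ler_norml; apply/andP; split; lra.
  by rewrite ler_norml => /andP[]; nra.
have h1 : j.+1%:Z <= w v t l.
  have : j.+1%:Z <= n v (l v).
    rewrite -(le_top wT) //; [|lra|lra].
    by move: e2; rewrite /l /line; lra.
  by rewrite -(w_at wT)// => /le_trans; apply; apply: (tops_mono wT) => //; exact: ltW.
have h2 : n u (line y1 s t u) <= w t u l.
  apply: (@le_trans _ _ (n u (l u))).
    by apply: (top_count_le wT); move: e1; rewrite /l /line; lra.
  by rewrite -(w_at wT)//; apply: (tops_mono wT) => //; exact: ltW.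
have h3 : w t t l <= k.
  rewrite (w_at wT)//; apply: hk; rewrite /l /line subrr mulr0 addr0; lra.
by move=> h4; clear -h0 h1 h2 h3 h4; lia.
Qed.

(* Cut the trapezoid above the chord by the segment [X] from [(t, y1')] to a point of the
   chord close to [(t, y1)]: the removed triangle accounts for the increment [k]. *)
Lemma tip_right t t' y1 y1' y2 (k : int) : al < t -> t < t' -> t' < be ->
  m <= y1 -> y1 < y1' ->
  (exists2 d, 0 < d & forall u, t < u -> u < t + d ->
     n u (chord t y1 t' y2 u) <= n t y1 - k) ->
  w t t' (chord t y1' t' y2) + k <= w t t' (chord t y1 t' y2).
Proof.
move=> at_ tt tb my yy [d d0 hd]; have tb' : t < be by lra.
set s := (y2 - y1) / (t' - t).
set l := chord t y1 t' y2; have bl : bent l by exact: bent_chord.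
have [d1 [d10 ad1 d1b _ hloc1]] := w_local wT y1 at_ tb'.
have [d2 [d20 ad2 d2b _ hloc2]] := w_local wT y1' at_ tb'.
(* With [r * A <= d1] the chord stays in the neighbourhood of [(t, y1)]; with [r * A <= y1' - y1]
   the segment [X] is steeper than the line from [(t, y1')] down to [(t', m)]. *)
set A := `|s| + (y1' - m) / (t' - t) + 1.
have g0 : 0 <= (y1' - m) / (t' - t) by apply: divr_ge0; lra.
have A1 : 1 <= A by rewrite /A; have := normr_ge0 s; lra.
pose r := Num.min (d / 2) (Num.min ((t' - t) / 2) (Num.min (d1 / A) ((y1' - y1) / A))).
have [r1 [r2 [r3 r4]]] : r <= d / 2 /\ r <= (t' - t) / 2 /\ r <= d1 / A /\ r <= (y1' - y1) / A.
  by rewrite /r !ge_min !lexx !orbT.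
have A0 : 0 < A by lra.
have r0 : 0 < r.
  rewrite /r !lt_min; have [h1 h2] : 0 < d1 / A /\ 0 < (y1' - y1) / A by split; apply: divr_gt0;
    lra.
  by rewrite h1 h2 !andbT; apply/andP; split; lra.
have {}r3 : r * A <= d1 by rewrite -ler_pdivlMr.
have {}r4 : r * A <= y1' - y1 by rewrite -ler_pdivlMr.
have rA : r <= r * A by nra.
pose tr := t + r.
(* The slope for which [X], starting at [(t, y1')], meets the chord at [tr]. *)
pose sx := s - (y1' - y1) / r.
pose X := line y1' sx t; have bX : bent X by exact: bent_line.
have lE u : l u = y1 + s * (u - t) by [].
have XE u : X u = y1' + sx * (u - t) by [].
have sxr : sx * r = s * r - (y1' - y1) by rewrite /sx mulrBl mulfVK// gt_eqF.
have Xtr : X tr = l tr by rewrite lE XE /tr (addrC t) addrK sxr; ring.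
have sn : `|s| * r <= r * A by rewrite /A; have := normr_ge0 s; nra.
have ns : - `|s| <= s <= `|s| by rewrite -ler_norml.
have lX u : u <= tr -> l u <= X u.
  move=> uu; have : (sx - s) * (u - t) >= (sx - s) * r.
    rewrite ler_wnM2l//; last by rewrite /tr in uu; lra.
    by rewrite /sx addrC addKr oppr_le0 divr_ge0; lra.
  by rewrite lE XE; lra.
have Xl u : tr <= u -> X u <= l u.
  move=> uu; have : (sx - s) * (u - t) <= (sx - s) * r.
    rewrite ler_wnM2l//; last by rewrite /tr in uu; lra.
    by rewrite /sx addrC addKr oppr_le0 divr_ge0; lra.
  by rewrite lE XE; lra.
have ttr : t <= tr by rewrite /tr; lra.
have trt : tr <= t' by rewrite /tr; lra.
have lw u v : t <= u -> u <= v -> v <= tr -> u = t -> w u v l = n t y1.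
  move=> tu uv vt ut; subst u; have lt : l t <= y1 by rewrite lE subrr mulr0 addr0.
  have v1 : v <= t + d1 by move: vt; rewrite /tr; lra.
  apply: (hloc1 _ _ _ bl _ (lexx t) uv v1 _ lt); first by lra.
  move=> z z1 z2; rewrite lE.
  have : s * (z - t) >= - `|s| * (z - t) by rewrite ler_wpM2r//; [lra|case/andP: ns].
  have : `|s| * (z - t) <= `|s| * r by rewrite ler_wpM2l//; move: vt; rewrite /tr; lra.
  lra.
pose e := Num.min (r / 2) (d2 / (`|sx| + 1)).
have sx1 : 0 < `|sx| + 1 by have := normr_ge0 sx; lra.
have e0 : 0 < e by rewrite /e lt_min divr_gt0//= divr_gt0.
have [e1 e2] : e <= r / 2 /\ e <= d2 / (`|sx| + 1) by rewrite /e !ge_min !lexx orbT.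
have {}e2 : e * (`|sx| + 1) <= d2 by rewrite -ler_pdivlMr.
pose v := t + e.
have [tv vtr] : t <= v /\ v <= tr by rewrite /v /tr; lra.
(* Split at [v], close to [t]. Over [[t, v]] the value is [n t y1']; over [[v, tr]] it is at most
   that of the chord, which is its section at [v]; and the subtracted section of [X] at [v] is at
   least [n t y1'] by [star_right]. *)
have key : w t tr X <= n t y1 - k.
  rewrite (tops_split wT bX tv vtr).
  have a1 : w t v X = n t y1'.
    apply: hloc2 => //; [lra| |move=> z z1 z2|by rewrite XE subrr mulr0 addr0].
      by rewrite /v; have := normr_ge0 sx; nra.
    rewrite XE; have nx : - `|sx| <= sx by have : - `|sx| <= sx <= `|sx| by [rewrite -ler_norml];
      case/andP.
    have : sx * (z - t) >= - `|sx| * (z - t) by rewrite ler_wpM2r//; lra.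
    have : `|sx| * (z - t) <= `|sx| * e by rewrite ler_wpM2l//; move: z2; rewrite /v; lra.
    nra.
  have a2 : w v tr X <= w v tr l by apply: (tops_mono wT) => // z _; exact: lX.
  have a3 : w v tr l = n v (l v).
    have := tops_split wT bl tv vtr; rewrite (lw t tr)// (lw t v)// (w_at wT)//; clear; lia.
  have a4 : n v (l v) <= n t y1 - k by apply: hd; rewrite /v; lra.
  have a5 : n t y1' <= w v v X.
    rewrite (w_at wT)//.
    apply: le_trans (star_right wT (q := t') at_ tb _ tv _ tt) _; [lra|lra|].
    apply: (top_count_le wT); rewrite XE.
    have : sx * r <= - ((y1' - m) / (t' - t)) * r.
      by rewrite sxr; move: r4; rewrite /A; nra.
    rewrite ler_pM2r// => hs; rewrite lerD2l.
    by rewrite -mulNr ler_wpM2r//; lra.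
  by rewrite a1; clear -a2 a3 a4 a5; lia.
rewrite -/l (tops_split wT bl ttr trt) lw//.
set l' := chord t y1' t' y2.
(* The new chord lies above both [X] and [l]; their maximum is split at [tr], where they meet. *)
pose l2 u := Num.max (X u) (l u).
have bl2 : bent l2 by exact: bent_max.
have : w t t' l' <= w t t' l2.
  apply: (tops_mono wT) => //; first exact: bent_chord.
  move=> u u1 u2; rewrite /l2 ge_max; apply/andP; split; last by apply: chord_le => //; lra.
  rewrite XE /l' /chord /line lerD2l ler_wpM2r//; first lra.
  rewrite -(ler_pM2r r0) sxr -/s.
  have -> : (y2 - y1') / (t' - t) = s - (y1' - y1) / (t' - t).
    by rewrite /s -mulrBl; congr (_ / _); ring.
  have : (y1' - y1) / (t' - t) * r <= y1' - y1.
    by rewrite mulrAC ler_pdivrMr; [rewrite ler_wpM2l//; lra|lra].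
  lra.
rewrite (tops_split wT bl2 ttr trt).
have b1 : w t tr l2 <= w t tr X.
  by apply: (tops_mono wT) => // u _ _; rewrite /l2 le_max lexx.
have b2 : w tr t' l2 <= w tr t' l.
  by apply: (tops_mono wT) => // u _ _; rewrite /l2 le_max lexx orbT.
have b3 : w tr tr l2 = w tr tr l by rewrite !(w_at wT)// /l2 Xtr maxxx.
by rewrite b3; clear -b1 b2 key; lia.
Qed.

End TopsRight.

(** * Links between tops at two times and the bound on antichains *)

Section Antichain.
Variables (R : realType) (w : R -> R -> (R -> R) -> int).
Variables (m M al be : R) (c : nat).
Hypothesis wT : tops w m M al be c.
Local Notation n := (top_count w).
Local Notation top := (top w m).
Local Notation slope := (slope w m).

Lemma tip_left t t' y1 y2 y2' (k : int) : al < t -> t < t' -> t' < be ->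
  m <= y2 -> y2 < y2' ->
  (exists2 d, 0 < d & forall u, t' - d < u -> u < t' ->
     n u (chord t y1 t' y2 u) <= n t' y2 - k) ->
  w t t' (chord t y1 t' y2') + k <= w t t' (chord t y1 t' y2).
Proof.
move=> at_ tt tb my yy [d d0 hd].
have swap z : (fun u => chord (- t') z (- t) y1 (- u)) = chord t y1 t' z.
  apply/funext => u; rewrite !chord_conv//; last by rewrite ltrN2.
  by rewrite addrC; congr (_ * _ + _ * _);
    field; rewrite ?subr_eq0 ?[_ - _ != 0]subr_eq0 ?opprK; lra.
have := @tip_right _ _ _ _ _ _ _ (tops_rev wT) (- t') (- t) y2 y2' y1 k.
rewrite !opprK !swap; apply => //; rewrite ?ltrN2//.
exists d => // u u1 u2; rewrite /top_count opprK.
have := hd (- u) ltac:(lra) ltac:(lra); rewrite -swap opprK.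
by [].
Qed.

(* A transitive relation whose chains are exactly the concave selections of tops, with the
   chosen slopes as supergradients. *)
Definition linked j t i u :=
  top i u <= line (top j t) (slope j t) t u /\ top j t <= line (top i u) (slope i u) u t.

(** Adding the two inequalities of a link shows that slopes decrease with time; the tangent at the
    first time therefore stays above the tangent at the second one beyond it, and symmetrically. *)
Lemma linked_trans j t i u k v : t < u -> u < v ->
  linked j t i u -> linked i u k v -> linked j t k v.
Proof.
rewrite /linked /line => tu uv [h1 h2] [h3 h4].
have s1 : slope i u <= slope j t.
  by rewrite -(@ler_pM2r _ (u - t)) ?subr_gt0//; lra.
have s2 : slope k v <= slope i u.
  by rewrite -(@ler_pM2r _ (v - u)) ?subr_gt0//; lra.
have e1 : slope i u * (v - u) <= slope j t * (v - u) by rewrite ler_wpM2r//; lra.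
have e2 : slope k v * (u - t) <= slope i u * (u - t) by rewrite ler_wpM2r//; lra.
split; lra.
Qed.

Lemma card_top_lt t (a : R) j : al < t -> t < be -> (j < c)%N -> top j t <= a ->
  (#|[set i : 'I_c | (a < top i t)%R]%SET| <= j)%N.
Proof.
move=> at_ tb jc ja; rewrite -[j]subn0; apply: card_ord_itv => i; rewrite inE /= => ai.
rewrite ltnNge; apply/negP => ji.
have := top_anti wT at_ tb ji (ltn_ord i); lra.
Qed.

(* Along the lower edge of the convex hull of the points indexed by [J1] and [J2], one of the
   two endpoints lies strictly outside the line chosen at the other; shrinking the trapezoid
   past it lowers the value by at least the number of tops removed. *)
Lemma antichain t t' : al < t -> t < t' -> t' < be ->
  forall (J1 J2 : {set 'I_c}) y1 y2, m <= y1 -> m <= y2 ->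
  (forall j, j \in J1 -> y1 <= top j t) -> (forall j, j \in J2 -> y2 <= top j t') ->
  (forall j i, j \in J1 -> i \in J2 -> ~ linked j t i t') ->
  (#|J1| + #|J2|)%:Z <= w t t' (chord t y1 t' y2).
Proof.
move=> at_ tt tb J1 J2.
have tb' : t < be by lra.
have at' : al < t' by lra.
have [N] := ubnP (#|J1| + #|J2|); elim: N J1 J2 => // N IH J1 J2 JN y1 y2 my1 my2 h1 h2 hJ.
have bc : bent (chord t y1 t' y2) by exact: bent_chord.
have [J10|[j1 j1J]] := set_0Vmem J1.
  rewrite J10 cards0 add0n; apply: (@le_trans _ _ (n t' y2)).
    rewrite (top_countE wT)//; rewrite lez_nat; apply: subset_leq_card.
    by apply/fintype.subsetP => j jJ; rewrite inE h2.
  rewrite -[in n _ _](chord_snd y1 y2 tt) -(w_at wT)//.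
  by apply: (tops_mono wT) => //; exact: ltW.
have [J20|[i1 i1J]] := set_0Vmem J2.
  rewrite J20 cards0 addn0; apply: (@le_trans _ _ (n t y1)).
    rewrite (top_countE wT)//; rewrite lez_nat; apply: subset_leq_card.
    by apply/fintype.subsetP => j jJ; rewrite inE h1.
  rewrite -[in n _ _](chord_fst t y1 t' y2) -(w_at wT)//.
  by apply: (tops_mono wT) => //; exact: ltW.
case: (@arg_maxnP _ j1 (fun j => j \in J1) val j1J) => j0 j0J j0max'.
have j0max (j : 'I_c) : j \in J1 -> (j <= j0)%N by exact: j0max'.
case: (@arg_maxnP _ i1 (fun j => j \in J2) val i1J) => i0 i0J i0max'.
have i0max (j : 'I_c) : j \in J2 -> (j <= i0)%N by exact: i0max'.
set a := top j0 t; set b := top i0 t'.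
have ma : m <= a by exact: (top_ge wT).
have mb : m <= b by exact: (top_ge wT).
apply: (@le_trans _ _ (w t t' (chord t a t' b))); last first.
  apply: (tops_mono wT) => //; first exact: bent_chord.
  by move=> u u1 u2; apply: chord_le => //; [exact: h1|exact: h2].
have amin j : j \in J1 -> a <= top j t.
  by move=> jJ; apply: (top_anti wT) => //; exact: j0max.
have bmin j : j \in J2 -> b <= top j t'.
  by move=> jJ; apply: (top_anti wT) => //; exact: i0max.
pose s := (b - a) / (t' - t).
have sE : s * (t' - t) = b - a by rewrite /s mulfVK// subr_eq0 gt_eqF.
have tt0 : 0 < t' - t by lra.
have [ls|sl] := ltP (slope j0 t) s.
  (* Remove from [J1] the tops of height exactly [a]. Their indices run from [N'], the number of
     tops above [a], to [j0], so [j0.+1 - N'] bounds their number, and it is also the gain given by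
     [slope_right]. *)
  have [y ay hy] := finite_gap (fun j : 'I_c => top j t) a.
  set J1' := [set j in J1 | a < top j t]%SET.
  set N' := #|[set j : 'I_c | a < top j t]%SET|.
  have N'j : (N' <= j0)%N by exact: card_top_lt.
  have cJ : (#|J1| <= #|J1'| + (j0.+1 - N'))%N.
    have -> : #|J1| = (#|J1'| + #|J1 :\: J1'|)%N.
      rewrite -(cardsID J1' J1); congr (_ + _)%N; apply: eq_card => j.
      by rewrite !inE andbA andbb.
    rewrite leq_add2l; apply: card_ord_itv => j; rewrite !inE => /andP[+ jJ].
    rewrite jJ /= -leNgt => ja; rewrite ltnS j0max// andbT.
    exact: card_top_lt.
  have cJ' : (#|J1'| < #|J1|)%N.
    apply: proper_card; apply/fintype.properP; split; first by apply/fintype.subsetP => j;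
      rewrite inE => /andP[].
    by exists j0 => //; rewrite !inE ltxx andbF.
  have NJ : (#|J1'| + #|J2| < N)%N by clear -JN cJ'; lia.
  have my : m <= y by lra.
  have ih : (#|J1'| + #|J2|)%:Z <= w t t' (chord t y t' b).
    apply: (IH _ _ NJ _ _ my mb) => [j|//|j i].
      by rewrite inE => /andP[_]; exact: hy.
    by rewrite inE => /andP[jJ _]; exact: hJ.
  suff h : exists2 d, 0 < d & forall u, t < u -> u < t + d ->
      n u (chord t a t' b u) <= n t a - (j0.+1 - N')%N%:Z.
    have := tip_right wT at_ tt tb ma ay h.
    by clear -ih cJ; lia.
  have nN z : a < z -> n t z <= N'%:Z.
    move=> az; rewrite (top_countE wT)//; last lra.
    rewrite lez_nat; apply: subset_leq_card; apply/fintype.subsetP => j; rewrite !inE; lra.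
  have [d d0 hd] := slope_right wT at_ tb' (ltn_ord j0) ls nN.
  exists d => // u u1 u2; have := hd u u1 u2; rewrite -/a /chord -/s.
  clear -N'j; lia.
(* Tops of equal height [b] may have different slopes. The smallest index is taken so that all
   removed indices lie between [i2] and [i0]; as it is not linked with [j0], its slope exceeds
   [s]. *)
case: (@arg_minnP _ i0 (fun j => (j \in J2) && (top j t' == b)) val).
  by rewrite i0J eqxx.
move=> i2 /andP[i2J /eqP i2b] i2min.
have ls : s < slope i2 t'.
  rewrite ltNge; apply/negP => ls; apply: (hJ j0 i2) => //; rewrite /linked /line i2b -/a.
  have e1 : s * (t' - t) <= slope j0 t * (t' - t) by rewrite ler_wpM2r// ltW.
  have e2 : slope i2 t' * (t' - t) <= s * (t' - t) by rewrite ler_wpM2r// ltW.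
  split; lra.
have [y ay hy] := finite_gap (fun j : 'I_c => top j t') b.
set J2' := [set j in J2 | b < top j t']%SET.
have cJ : (#|J2| <= #|J2'| + (i0.+1 - i2))%N.
  have -> : #|J2| = (#|J2'| + #|J2 :\: J2'|)%N.
    rewrite -(cardsID J2' J2); congr (_ + _)%N; apply: eq_card => j.
    by rewrite !inE andbA andbb.
  rewrite leq_add2l; apply: card_ord_itv => j; rewrite !inE => /andP[+ jJ].
  rewrite jJ /= -leNgt => ja; rewrite ltnS i0max// andbT.
  by apply: i2min; rewrite jJ eq_le ja bmin.
have cJ' : (#|J2'| < #|J2|)%N.
  apply: proper_card; apply/fintype.properP; split; first by apply/fintype.subsetP => j; rewrite
    inE => /andP[].
  by exists i0 => //; rewrite !inE ltxx andbF.
have NJ : (#|J1| + #|J2'| < N)%N by clear -JN cJ'; lia.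
have my : m <= y by lra.
have ih : (#|J1| + #|J2'|)%:Z <= w t t' (chord t a t' y).
  apply: (IH _ _ NJ _ _ ma my) => [//|j|j i jJ].
    by rewrite inE => /andP[_]; exact: hy.
  by rewrite inE => /andP[iJ _]; exact: hJ.
suff h : exists2 d, 0 < d & forall u, t' - d < u -> u < t' ->
    n u (chord t a t' b u) <= n t' b - (i0.+1 - i2)%N%:Z.
  have := tip_left at_ tt tb mb ay h.
  by clear -ih cJ; lia.
have [d d0 hd] := slope_left wT at' tb (ltn_ord i2) ls.
exists (Num.min d (t' - t)); first by rewrite lt_min d0 tt0.
move=> u u1 u2; have [ud ut] : t' - d < u /\ t < u.
  have : Num.min d (t' - t) <= d /\ Num.min d (t' - t) <= t' - t by rewrite !ge_min !lexx orbT.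
  lra.
(* At [u] the top [i2] is strictly below the chord, so at most [i2] tops reach it, against at least
   [i0.+1] that reach [b] at [t']. *)
have := hd u ud u2; rewrite i2b -[line b s t']/(line b ((b - a) / (t' - t)) t').
rewrite -chord_snd_line// ltNge (le_top wT)//; [|lra|lra].
have := top_count_top wT at' tb (ltn_ord i0); rewrite -/b.
have := i0max _ i2J; clear.
rewrite /chord; set x := n u _; set x' := n t' b; lia.
Qed.

Lemma linked_antichain t t' (J1 J2 : {set 'I_c}) : al < t -> t < t' -> t' < be ->
  (forall j i, j \in J1 -> i \in J2 -> ~ linked j t i t') -> (#|J1| + #|J2| <= c)%N.
Proof.
move=> at_ tt tb hJ; rewrite -lez_nat -(tops_strip wT at_ (ltW tt) tb).
have -> : (fun=> m) = chord t m t' m.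
  by apply/funext => u; rewrite /chord /line subrr mul0r mul0r addr0.
apply: antichain => // j _; apply: (top_ge wT) => //; lra.
Qed.

End Antichain.

(** * Concave tops via Hall's marriage theorem *)

Section Hall.
Variables T U : finType.
Implicit Types (e : T -> U -> bool) (A J : {set T}).

Definition neighbours e J : {set U} := [set u | [exists x in J, e x u]]%SET.

(** Induction on the set to be matched, for all relations at once, because deleting used partners
    changes the relation; [f0] starts it on the empty set. *)
Lemma hall_matching e (f0 : T -> U) :
  (forall J, (#|J| <= #|neighbours e J|)%N) ->
  exists f : T -> U, injective f /\ forall x, e x (f x).
Proof.
suff gen : forall A e', (forall J, J \subset A -> (#|J| <= #|neighbours e' J|)%N) ->
    exists f : T -> U, {in A &, injective f} /\ {in A, forall x, e' x (f x)}.
  move=> h; have [|f [fi fe]] := gen [set: T]%SET e; first by move=> J _; exact: h.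
  by exists f; split=> [x y|x]; [apply: fi|apply: fe]; rewrite ?inE.
move=> A; have [N] := ubnP #|A|; elim: N A => // N IH A AN e' hA.
have [->|[a aA]] := set_0Vmem A; first by exists f0; split => x; rewrite inE.
(* Either a proper nonempty [J] has no spare neighbour, and [J] and its complement are matched
   separately, or all such sets have one, and an arbitrary edge can be fixed. *)
have [[J [JA J0 JnA JJ]]|tight] := pselect (exists J, [/\ J \subset A, J != finset.set0,
    J != A & (#|neighbours e' J| <= #|J|)%N]).
  have JpA : J \proper A by rewrite finset.properEneq JnA.
  have cJ := proper_card JpA.
  have [|f1 [f1i f1e]] := IH J ltac:(lia) e'.
    by move=> K KJ; apply: hA; exact: fintype.subset_trans JA.
  pose e2 x u := e' x u && (u \notin neighbours e' J).
  have cD : #|A :\: J| = (#|A| - #|J|)%N.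
    by rewrite cardsD (finset.setIidPr JA).
  have J1 : (0 < #|J|)%N by rewrite card_gt0.
  have [|f2 [f2i f2e]] := IH (A :\: J) ltac:(lia) e2.
    move=> K KAJ.
    have KA : K \subset A := fintype.subset_trans KAJ (subsetDl A J).
    have dKJ : K :&: J = finset.set0.
      apply/setP => x; rewrite !inE; apply/negP => /andP[/(fintype.subsetP KAJ)].
      by rewrite inE => /andP[/negP].
    have cKJ : #|K :|: J| = (#|K| + #|J|)%N by rewrite cardsU dKJ cards0 subn0.
    have := hA (K :|: J); rewrite finset.subUset KA JA cKJ => /(_ isT).
    have -> : neighbours e' (K :|: J) = neighbours e2 K :|: neighbours e' J.
      apply/setP => u; rewrite !inE; apply/existsP/idP.
        move=> [x /andP[]]; rewrite inE => /orP[xK xu|xJ xu].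
          have [uJ|uJ] := boolP (u \in neighbours e' J).
            by rewrite inE in uJ; rewrite uJ orbT.
          by apply/orP; left; apply/existsP; exists x; rewrite xK /e2 xu.
        by apply/orP; right; apply/existsP; exists x; rewrite xJ.
      case/orP => /existsP[x /andP[xK xu]]; exists x; rewrite inE xK ?orbT//=.
      by case/andP: xu.
    have : (#|neighbours e2 K :|: neighbours e' J| <= #|neighbours e2 K| + #|neighbours e' J|)%N.
      by rewrite cardsU leq_subr.
    lia.
  exists (fun x => if x \in J then f1 x else f2 x); split => [x y xA yA|x xA].
    have N1 z : z \in J -> f1 z \in neighbours e' J.
      by move=> zJ; rewrite inE; apply/existsP; exists z; rewrite zJ f1e.
    have N2 z : z \in A -> z \notin J -> f2 z \notin neighbours e' J.
      by move=> zA zJ; have /andP[] : e2 z (f2 z) by apply: f2e; rewrite inE zJ.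
    case: ifPn => xJ; case: ifPn => yJ.
    - exact: f1i.
    - by move=> E; have := N2 y yA yJ; rewrite -E N1.
    - by move=> E; have := N2 x xA xJ; rewrite E N1.
    - by apply: f2i; rewrite inE ?xJ ?yJ.
  case: ifPn => xJ; first exact: f1e.
  by have /andP[] : e2 x (f2 x) by apply: f2e; rewrite inE xJ.
have [u au] : exists u, e' a u.
  have := hA [set a]%SET; rewrite finset.sub1set aA cards1 => /(_ isT) /card_gt0P[u].
  by rewrite inE => /existsP[x /andP[]]; rewrite inE => /eqP -> xu; exists u.
pose e2 x v := e' x v && (v != u).
have cA : #|A| = (#|A :\ a|).+1 by rewrite (cardsD1 a) aA.
have [|f [fi fe]] := IH (A :\ a) ltac:(lia) e2.
  move=> K KA.
  have [->|K0] := eqVneq K finset.set0; first by rewrite cards0.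
  have aK : a \notin K by apply/negP => /(fintype.subsetP KA); rewrite !inE eqxx.
  have KA' : K \subset A by apply: fintype.subset_trans KA (subsetDl _ _).
  have : (#|K| < #|neighbours e' K|)%N.
    rewrite ltnNge; apply/negP => h; apply: tight; exists K; split => //.
    by apply/negP => /eqP KE; rewrite KE aA in aK.
  have -> : neighbours e2 K = neighbours e' K :\ u.
    apply/setP => v; rewrite !inE; apply/existsP/idP.
      move=> [x /and3P[xK xv ->]] /=; apply/existsP; exists x; exact/andP.
    by move=> /andP[vu /existsP[x /andP[xK xv]]]; exists x; rewrite xK /e2 xv.
  rewrite (cardsD1 u (neighbours e' K)); case: (u \in _) => /=; lia.
exists (fun x => if x == a then u else f x); split => [x y xA yA|x xA].
  have fu z : z \in A -> z != a -> f z != u.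
    by move=> zA za; have /andP[] : e2 z (f z) by apply: fe; rewrite !inE za.
  case: eqVneq => [->|xa]; case: eqVneq => [->|ya] //.
  - by move=> E; have := fu y yA ya; rewrite -E eqxx.
  - by move=> E; have := fu x xA xa; rewrite E eqxx.
  - by apply: fi; rewrite !inE ?xa ?ya.
case: eqVneq => [->//|xa].
by have /andP[] : e2 x (f x) by apply: fe; rewrite !inE xa.
Qed.

End Hall.

Section Decomposition.
Variables (R : realType) (w : R -> R -> (R -> R) -> int).
Variables (m M al be : R) (c : nat).
Hypothesis wT : tops w m M al be c.
Local Notation n := (top_count w).
Local Notation top := (top w m).
Local Notation slope := (slope w m).
Local Notation linked := (linked w m).

Lemma linked_matching t t' : al < t -> t < t' -> t' < be ->
  exists f : 'I_c -> 'I_c, injective f /\ forall i, linked (f i) t i t'.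
Proof.
move=> at_ tt tb.
pose e (i j : 'I_c) := `[< linked j t i t' >].
have [|f [fi fe]] := @hall_matching _ _ e id.
  (* [J] at [t'] and the non-neighbours of [J] at [t] form an antichain; its bound by [c] is Hall's
     condition. *)
  move=> J; rewrite -(leq_add2l #|~: neighbours e J|) [X in (_ <= X)%N]addnC cardsC card_ord.
  apply: (linked_antichain wT at_ tt tb) => j i; rewrite !inE => /existsPn /(_ i) + iJ lk.
  by rewrite iJ /= /e asboolT.
by exists f; split => // i; apply/asboolP; exact: fe.
Qed.

(** Only consecutive times are matched. The matching to a new earliest time is composed with the
    labels at the next one, and transitivity links it to all later times. *)
Lemma linked_sorted (S : seq R) : (forall t, t \in S -> al < t < be) -> sorted <%R S ->
  exists sg : R -> 'I_c -> 'I_c, (forall t, t \in S -> injective (sg t)) /\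
    forall t u, t \in S -> u \in S -> t < u -> forall i, linked (sg t i) t (sg u i) u.
Proof.
elim: S => [|t [|t' S] IH] hS sS; first by exists (fun _ => id).
  exists (fun _ => id); split=> [x _ //|x y]; rewrite !inE => /eqP -> /eqP ->.
  by rewrite ltxx.
have [tt' sS'] : t < t' /\ sorted <%R (t' :: S) by move: sS => /= /andP[].
have tlt x : x \in t' :: S -> t < x.
  have /order_path_min /allP : path <%R t (t' :: S) by [].
  by apply => //; exact: lt_trans.
have [|sg [inj lk]] := IH _ sS'; first by move=> x xS; apply: hS; rewrite inE xS orbT.
have [/andP[at_ _] /andP[_ tb]] : al < t < be /\ al < t' < be.
  by split; apply: hS; rewrite !inE eqxx ?orbT.
have [f [fi fe]] := linked_matching at_ tt' tb.
have t'S : t' \in t' :: S by rewrite inE eqxx.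
exists (fun x => if x == t then f \o sg t' else sg x); split => [x|x y].
  rewrite inE; case: eqVneq => [_ _|_ /= xS]; last exact: inj.
  by apply: inj_comp => //; exact: inj.
rewrite inE [y \in _]inE; case: (eqVneq x t) => [->|xt] /=.
  case: (eqVneq y t) => [->|yt] /=; first by rewrite ltxx.
  move=> _ yS _ i; have [->|yt'] := eqVneq y t'; first exact: fe.
  have t'y : t' < y.
    move: yS; rewrite inE (negPf yt') /= => yS.
    have /order_path_min /allP : path <%R t' S by [].
    by apply => //; exact: lt_trans.
  apply: (linked_trans tt' t'y) (fe (sg t' i)) _; exact: lk.
case: (eqVneq y t) => [->|yt] /= xS; last exact: lk.
by move=> _ xlt; have := tlt x xS; rewrite ltNge ltW.
Qed.

(* Compactness: coherent matchings exist over every finite set of times, and an ultrafilter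
   on these sets selects one over all times. *)
Lemma linked_family : exists sg : R -> 'I_c -> 'I_c,
  (forall t, al < t < be -> injective (sg t)) /\
  forall t u, al < t -> t < u -> u < be -> forall i, linked (sg t i) t (sg u i) u.
Proof.
pose P (S : seq R) (sg : R -> {ffun 'I_c -> 'I_c}) :=
  (forall t, t \in S -> al < t < be -> injective (sg t)) /\
  forall t u, t \in S -> u \in S -> al < t -> t < u -> u < be ->
    forall i, linked (sg t i) t (sg u i) u.
have /choice[Sg SgP] : forall S, exists sg, P S sg.
  move=> S; pose S' := sort <=%R (undup [seq t <- S | al < t < be]).
  have memS' t : (t \in S') = (al < t < be) && (t \in S).
    by rewrite mem_sort mem_undup mem_filter.
  have [||sg [inj lk]] := @linked_sorted S'.
  - by move=> t; rewrite memS' => /andP[].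
  - by rewrite sort_lt_sorted undup_uniq.
  exists (fun t => [ffun i => sg t i]); split.
    move=> t tS tab i j; rewrite !ffunE; apply: inj; by rewrite memS' tab.
  move=> t u tS uS at_ tu ub i; rewrite !ffunE; apply: lk => //;
    by rewrite memS' ?tS ?uS andbT; apply/andP; split; lra.
pose F : set_system (seq R) :=
  filter_from setT (fun S0 : seq R => [set S : seq R | {subset S0 <= S}]).
have FF : ProperFilter F.
  apply: filter_from_proper; last by move=> S0 _; exists S0.
  apply: filter_from_filter; first by exists [::].
  move=> S1 S2 _ _; exists (S1 ++ S2) => // S hS; split => x xS; apply: hS;
    by rewrite mem_cat xS ?orbT.
have [G [GU FG]] := ultraFilterLemma FF.
have Gin t : G [set S : seq R | t \in S].
  by apply: FG; exists [:: t] => // S; apply; rewrite inE.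
(* There are finitely many maps [f]: if none were the value of [Sg S t] for almost all [S], then
   almost all [S] would avoid every one of them. *)
have /choice[pi hpi] : forall t, exists f, G [set S | Sg S t = f].
  move=> t; apply: contrapT => /forallNP h.
  have : \forall S \near G, forall f, Sg S t <> f.
    apply: filter_forall => f.
    by have [|//] := in_ultra_setVsetC [set S | Sg S t = f] GU; move/(h f).
  by move=> /filter_ex[S /(_ (Sg S t))].
exists (fun t => pi t : 'I_c -> 'I_c); split.
  move=> t tab; have [S [tS <-]] := filter_ex (filterI (Gin t) (hpi t)).
  by have [h _] := SgP S; exact: h.
move=> t u at_ tu ub.
have [S [[tS uS] [<- <-]]] := filter_ex
  (filterI (filterI (Gin t) (Gin u)) (filterI (hpi t) (hpi u))).
by have [_ h] := SgP S; exact: h.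
Qed.

(** Each [sg t] is a permutation of the labels, so relabelling keeps the count; a link gives the
    tangent inequality both forward and backward in time. *)
Lemma tops_decomposition : exists g s : 'I_c -> R -> R,
  (forall i t u, al < t < be -> al < u < be -> g i u <= line (g i t) (s i t) t u) /\
  (forall t y, al < t < be -> m <= y -> n t y = #|[set i | y <= g i t]%SET|%:Z).
Proof.
have [sg [inj lk]] := linked_family.
exists (fun i t => top (sg t i) t), (fun i t => slope (sg t i) t); split.
  move=> i t u /andP[at_ tb] /andP[au ub].
  have [tu|ut|->] := ltgtP t u.
  - by have [] := lk t u at_ tu ub i.
  - by have [] := lk u t au ut tb i.
  - by rewrite /line subrr mulr0 addr0.
move=> t y /andP[at_ tb] my; rewrite (top_countE wT)//; congr Posz.
have injt : injective (sg t) by apply: inj; rewrite at_.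
rewrite -(card_preimset _ injt); apply: eq_card => i; by rewrite !inE.
Qed.

End Decomposition.

(** * Compact convex sets in the plane *)

Section Plane.
Variable R : realType.
Local Notation V := 'rV[R]_2.
Implicit Types (A B : set V) (x y : V).

Definition cx x : R := x ord0 ord0.
Definition cy x : R := x ord0 ord_max.
Definition pt (a b : R) : V := \row_j (if j == ord0 then a else b).

Lemma cx_pt a b : cx (pt a b) = a. Proof. by rewrite /cx mxE. Qed.
Lemma cy_pt a b : cy (pt a b) = b. Proof. by rewrite /cy mxE. Qed.

Lemma ord2P (P : 'I_2 -> Prop) : P ord0 -> P ord_max -> forall i, P i.
Proof.
move=> h0 h1 [[|[|//]] hi].
  by have -> : Ordinal hi = ord0 by exact: val_inj.
by have -> : Ordinal hi = ord_max by exact: val_inj.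
Qed.

Lemma rV2_eq x y : cx x = cx y -> cy x = cy y -> x = y.
Proof. by move=> h0 h1; apply/rowP; apply: ord2P. Qed.

Lemma cxD x y : cx (x + y) = cx x + cx y. Proof. by rewrite /cx mxE. Qed.
Lemma cyD x y : cy (x + y) = cy x + cy y. Proof. by rewrite /cy mxE. Qed.
Lemma cxB x y : cx (x - y) = cx x - cx y. Proof. by rewrite /cx !mxE. Qed.
Lemma cyB x y : cy (x - y) = cy x - cy y. Proof. by rewrite /cy !mxE. Qed.
Lemma cxZ a x : cx (a *: x) = a * cx x. Proof. by rewrite /cx mxE. Qed.
Lemma cyZ a x : cy (a *: x) = a * cy x. Proof. by rewrite /cy mxE. Qed.

Lemma dotpE x y : dotp x y = cx x * cx y + cy x * cy y.
Proof.
rewrite /dotp big_ord_recl big_ord1; congr (_ + _).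
by have -> : lift ord0 ord0 = ord_max :> 'I_2 by exact: val_inj.
Qed.

Lemma continuous_cx : continuous cx. Proof. exact: coord_continuous. Qed.
Lemma continuous_cy : continuous cy. Proof. exact: coord_continuous. Qed.

Lemma continuous_aff a b : continuous (fun x => a * cx x + b * cy x).
Proof.
move=> x; have h1 := @continuous_cx x; have h2 := @continuous_cy x.
exact: (cvgD (cvgM (cvg_cst a) h1) (cvgM (cvg_cst b) h2)).
Qed.

Lemma convex_setP A : convex_set A <->
  forall x y t, 0 <= t -> t <= 1 -> A x -> A y -> A (t *: x + (1 - t) *: y).
Proof.
split=> [h x y t t0 t1 Ax Ay|h x y l].
  have t01 : Itv.spec (@Itv.num_sem R) (Itv.Real `[0%Z, 1%Z]) t.
    by apply/andP; split; [exact: ger0_real|rewrite in_itv /= t0 t1].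
  exact: (set_mem (h x y (Itv.mk t01) (mem_set Ax) (mem_set Ay))).
move=> /set_mem Ax /set_mem Ay; apply/mem_set; apply: h => //.
Qed.

Definition ccl A := closed A /\ convex_set A.
Definition ccp A := compact A /\ convex_set A.

Lemma ccp_ccl A : ccp A -> ccl A.
Proof. by case=> cA vA; split => //; apply: compact_closed => //; exact: norm_hausdorff. Qed.

Lemma ccl_bigI I (D : set I) (F : I -> set V) :
  (forall i, D i -> ccl (F i)) -> ccl (\bigcap_(i in D) F i).
Proof.
move=> h; split; first by apply: closed_bigI => i /h[].
apply/convex_setP => x y t t0 t1 hx hy i Di.
by have [_ /convex_setP] := h i Di; apply => //; [exact: hx|exact: hy].
Qed.

Lemma cclI A B : ccl A -> ccl B -> ccl (A `&` B).
Proof.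
move=> [cA vA] [cB vB]; split; first exact: closedI.
apply/convex_setP => x y t t0 t1 [Ax Bx] [Ay By].
by split; [move/convex_setP: vA|move/convex_setP: vB]; apply.
Qed.

Lemma ccl_half a b c : ccl [set x | a * cx x + b * cy x <= c].
Proof.
split.
  apply: (@preimage_closed _ _ (fun x => a * cx x + b * cy x) [set z | z <= c]);
    last exact: closed_le.
  by move=> x _; exact: continuous_aff.
apply/convex_setP => x y t t0 t1 /= hx hy; rewrite cxD cyD !cxZ !cyZ; nra.
Qed.

Lemma ccl_le_cx c : ccl [set x | cx x <= c].
Proof.
rewrite (_ : mkset _ = [set x | 1 * cx x + 0 * cy x <= c]); first exact: ccl_half.
by apply/seteqP; split => x /=; rewrite mul1r mul0r addr0.
Qed.

Lemma ccl_ge_cx c : ccl [set x | c <= cx x].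
Proof.
rewrite (_ : mkset _ = [set x | (-1) * cx x + 0 * cy x <= - c]); first exact: ccl_half.
by apply/seteqP; split => x /=; lra.
Qed.

Lemma ccl_le_cy e c : ccl [set x | e * cy x <= c].
Proof.
rewrite (_ : mkset _ = [set x | 0 * cx x + e * cy x <= c]); first exact: ccl_half.
by apply/seteqP; split => x /=; rewrite mul0r add0r.
Qed.

Lemma ccl_ge_cy e c : ccl [set x | c <= e * cy x].
Proof.
rewrite (_ : mkset _ = [set x | 0 * cx x + (- e) * cy x <= - c]); first exact: ccl_half.
by apply/seteqP; split => x /=; lra.
Qed.

Definition box p q m M : set V := [set x | p <= cx x <= q /\ m <= cy x <= M].

Lemma compact_box p q m M : compact (box p q m M).
Proof.
pose A (i : 'I_2) := if i == ord0 then `[p, q]%classic else `[m, M]%classic.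
have := @rV_compact R _ A; rewrite (_ : mkset _ = box p q m M).
  by apply; apply: ord2P; exact: segment_compact.
apply/seteqP; split => x /=.
  by move=> h; have := h ord0; have := h ord_max; rewrite /A /= !in_itv.
by move=> [h1 h2]; apply: ord2P; rewrite /A /= in_itv.
Qed.

Lemma ccp_sub A p q m M : ccl A -> A `<=` box p q m M -> ccp A.
Proof.
by move=> [cA vA] AB; split => //; apply: (subclosed_compact cA (@compact_box p q m M)).
Qed.

Lemma box_bounded A : compact A -> exists r, 0 < r /\ A `<=` box (- r) r (- r) r.
Proof.
move=> /compact_bounded [r [_ hr]]; exists (`|r| + 1).
have r0 := normr_ge0 r; split; first lra.
have rr : r < `|r| + 1 by have := ler_norm r; lra.
move=> x Ax; have := hr _ rr x Ax; rewrite /Num.norm /= mx_normrE => hx.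
have h i : `|x ord0 i| <= `|r| + 1.
  by apply: le_trans hx; rewrite (bigmax_sup (ord0, i)).
by split; rewrite -ler_norml; exact: h.
Qed.

Lemma ccpI A B : ccp A -> ccl B -> ccp (A `&` B).
Proof.
move=> cA cB; have [r [_ Ar]] := box_bounded cA.1.
exact: (ccp_sub (cclI (ccp_ccl cA) cB) (fun x h => Ar x h.1)).
Qed.

Lemma ccp_set1 x : ccp [set x].
Proof.
split; first exact: compact_set1.
by apply/convex_setP => y z t _ _ -> ->; rewrite -scalerDl addrC subrK scale1r.
Qed.

Lemma ccp_set0 : ccp set0.
Proof. by split; [exact: compact0|apply/convex_setP]. Qed.

Lemma ccp_body (K : K2 R) : ccp K.
Proof. by split; [exact: body_compact|exact: body_convex]. Qed.

Lemma ccl_box p q m M : ccl (box p q m M).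
Proof.
rewrite (_ : box p q m M = ([set x | p <= cx x] `&` [set x | cx x <= q]) `&`
    ([set x | m <= 1 * cy x] `&` [set x | 1 * cy x <= M])).
  by apply: cclI; apply: cclI; [exact: ccl_ge_cx|exact: ccl_le_cx|exact: ccl_ge_cy|exact:
    ccl_le_cy].
by apply/seteqP; split => x /=; rewrite mul1r => -[]; [move=> /andP[-> ->] /andP[-> ->]|
  move=> [h1 h2] [h3 h4]; rewrite /box /= h1 h2 h3 h4].
Qed.

Lemma ccp_box p q m M : ccp (box p q m M).
Proof. exact: (ccp_sub (@ccl_box p q m M) (@subset_refl _ _)). Qed.

Lemma K2_ext (K L : K2 R) : (K : set V) = L -> K = L.
Proof.
case: K L => [K cK vK] [L cL vL] /= E; subst L.
by rewrite (Prop_irrelevance cK cL) (Prop_irrelevance vK vL).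
Qed.

Definition K2of A : K2 R :=
  if pselect (ccp A) is left h then MkK2 h.1 h.2 else K2_empty R.

Lemma K2ofE A : ccp A -> K2of A = A :> set V.
Proof. by rewrite /K2of; case: pselect. Qed.

Lemma K2of_body (K : K2 R) : K2of K = K.
Proof. by apply: K2_ext; rewrite K2ofE//; exact: ccp_body. Qed.

End Plane.

Section Value.
Variables (R : realType) (phi : K2 R -> int).
Local Notation V := 'rV[R]_2.
Implicit Types (A B : set V).

(* The value of [phi] on a set; sets that are not compact convex get [phi set0]. *)
Definition vl A : int := phi (K2of A).

Lemma vl_body (K : K2 R) : vl K = phi K.
Proof. by rewrite /vl K2of_body. Qed.

Lemma vl_union A B : K2_valuation phi -> ccp A -> ccp B -> ccp (A `|` B) ->
  vl (A `|` B) = vl A + vl B - vl (A `&` B).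
Proof.
move=> [_ h] cA cB cAB; rewrite /vl -(h (K2of A) (K2of B) (K2of (A `|` B))); last by rewrite !K2ofE.
rewrite [K2of (A `&` B)](_ : _ = K2_inter (K2of A) (K2of B)) ?addrK//.
by apply: K2_ext; rewrite /= !K2ofE//; apply: ccpI => //; exact: ccp_ccl.
Qed.

Lemma vl0 : K2_valuation phi -> vl set0 = 0.
Proof.
move=> [<- _]; rewrite /vl; congr phi; apply: K2_ext; rewrite K2ofE//; exact: ccp_set0.
Qed.

Lemma vl_split A B C : K2_valuation phi -> ccp A -> ccl B -> ccl C ->
  A `<=` B `|` C -> vl A = vl (A `&` B) + vl (A `&` C) - vl (A `&` (B `&` C)).
Proof.
move=> hv cA cB cC ABC.
have E : A = (A `&` B) `|` (A `&` C).
  by rewrite -setIUr; apply/esym/setIidl.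
rewrite {1}E vl_union//; [|exact: ccpI|exact: ccpI|by rewrite -E].
by rewrite setIACA setIid.
Qed.

Lemma vl_mono A B : K2_monotone phi -> ccp A -> ccp B -> A `<=` B -> vl A <= vl B.
Proof. by move=> hm cA cB AB; apply: hm; rewrite !K2ofE. Qed.

Lemma vl_sigma (A : nat -> set V) B : K2_sigma_continuous phi ->
  (forall n, ccp (A n)) -> (forall n, A n.+1 `<=` A n) -> \bigcap_n A n = B ->
  exists N, forall n, (N <= n)%N -> vl (A n) = vl B.
Proof.
move=> hs cA dA AB.
have cB : ccp B.
  have /ccp_ccl cB := cA 0%N; rewrite -(@setIidr _ (A 0%N) B).
    by apply: ccpI => //; rewrite -AB; apply: ccl_bigI => n _; exact: ccp_ccl.
  by rewrite -AB => x; apply.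
have h1 n : K2of (A n.+1) `<=` K2of (A n) by rewrite !K2ofE.
have h2 : \bigcap_n K2of (A n) = K2of B.
  by rewrite K2ofE// -AB; apply: eq_bigcapr => n _; rewrite K2ofE.
have hc := hs (fun n => K2of (A n)) _ h1 h2.
(* Integers at distance less than 1 are equal. *)
move/cvgrPdist_lt : hc => /(_ 1 ltr01) [N _ hN].
exists N => n Nn; have := hN n Nn; rewrite /= -rmorphB /= -intr_norm ltrz1.
rewrite /vl; lia.
Qed.

End Value.

Section IntervalInduction.
Variable R : realType.

(** Bisection in the form of a supremum argument. The hypotheses are one-sided because the
    applications control an interval only when [t] is one of its ends. *)
Lemma interval_induction (P : R -> R -> Prop) :
  (forall a b c, a <= b -> b <= c -> P a b -> P b c -> P a c) ->
  (forall t, exists2 d, 0 < d & forall s, t - d <= s -> s <= t -> P s t) ->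
  (forall t, exists2 d, 0 < d & forall s, t <= s -> s <= t + d -> P t s) ->
  forall a b, a <= b -> P a b.
Proof.
move=> glue left_ right_ a b ab.
pose S := [set x | [/\ a <= x, x <= b & P a x]].
have Sa : S a by split => //; have [d d0] := right_ a; apply; lra.
have hS : has_sup S by split; [exists a|exists b => x []].
set s := sup S.
have as_ : a <= s by apply: ub_le_sup => //; case: hS.
have sb : s <= b by apply: ge_sup; [exists a|move=> x []].
have Pas : P a s.
  have [d d0 hd] := left_ s; have [x [ax xb Px] xs] := sup_adherent d0 hS.
  have xs' : x <= s by apply: ub_le_sup; [case: hS|split].
  by apply: (glue a x s) => //; apply: hd => //; exact: ltW.
have [->//|sb'] := eqVneq b s.
have {}sb : s < b by rewrite lt_neqAle eq_sym sb'.
have [d d0 hd] := right_ s; pose y := Num.min b (s + d).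
have [yb yd] : y <= b /\ y <= s + d by rewrite /y !ge_min !lexx orbT.
have sy : s < y by rewrite /y lt_min sb ltrDl.
suff : y <= s by lra.
apply: ub_le_sup; first by case: hS.
split => //; first lra.
by apply: (glue a s y) => //; [lra|apply: hd; lra].
Qed.

End IntervalInduction.

(** * A sigma-continuous valuation is determined by its point values *)

Section Uniqueness.
Variable R : realType.
Local Notation V := 'rV[R]_2.
Implicit Types (phi psi : K2 R -> int) (A B : set V).

Definition slab (u v a b : R) : set V :=
  [set x | a <= u * cx x + v * cy x <= b].

Lemma ccl_slab u v a b : ccl (slab u v a b).
Proof.
rewrite (_ : slab u v a b = [set x | (- u) * cx x + (- v) * cy x <= - a] `&`
    [set x | u * cx x + v * cy x <= b]); first by apply: cclI; exact: ccl_half.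
by apply/seteqP; split => x; rewrite /slab /=; [move=> /andP[] | move=> [] ]; lra.
Qed.

Lemma slab_opp u v a b : slab (- u) (- v) a b = slab u v (- b) (- a).
Proof. by apply/seteqP; split => x; rewrite /slab /=; lra. Qed.

Lemma slab_sub A u v a b c d : a <= c -> d <= b ->
  A `&` slab u v a b `&` slab u v c d = A `&` slab u v c d.
Proof.
move=> ac db; apply/seteqP; split=> x; rewrite /slab /=; first by move=> [[Ax _] h].
move=> [Ax /andP[h1 h2]]; split; first by split => //; apply/andP; split; lra.
by apply/andP.
Qed.

Lemma slabI u v a b c : a <= b -> b <= c -> slab u v a b `&` slab u v b c = slab u v b b.
Proof.
move=> ab bc; apply/seteqP; split=> x; rewrite /slab /=.
  by move=> [/andP[h1 h2] /andP[h3 h4]]; apply/andP.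
by move=> /andP[h1 h2]; split; apply/andP; split; lra.
Qed.

Section Vanishing.
Variable phi : K2 R -> int.
Hypothesis hs : K2_sigma_continuous phi.
Variables (A : set V) (u v : R).
Hypothesis cA : ccp A.

(** This is applied to a difference of valuations, which need not be monotone: a nonzero value on
    one slab says nothing about thinner ones, so a whole sequence of slabs with nonzero values
    shrinking to the line is built against sigma-continuity. *)
Lemma vl_slab_right t : vl phi (A `&` slab u v t t) = 0 ->
  exists2 d, 0 < d & forall s, t <= s -> s <= t + d -> vl phi (A `&` slab u v t s) = 0.
Proof.
move=> h0; apply: contrapT => hn.
have hd d : 0 < d -> exists s, [/\ t < s, s <= t + d & vl phi (A `&` slab u v t s) <> 0].
  move=> d0; apply: contrapT => hs'; apply: hn; exists d => // s ts sd.
  have [->//|st] := eqVneq s t.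
  apply: contrapT => vs; apply: hs'; exists s; split => //.
  by rewrite lt_neqAle eq_sym st.
(* Right ends of slabs with nonzero value; dependent choice halves the width at each step. *)
pose T := {s | t < s /\ vl phi (A `&` slab u v t s) <> 0}.
have step (x : T) : {y : T | sval y <= t + (sval x - t) / 2}.
  apply: cid; case: x => s [ts _] /=.
  have [|y [ty yd vy]] := hd ((s - t) / 2); first by apply: divr_gt0; lra.
  by exists (exist _ y (conj ty vy)).
have [s0 [ts0 _ v0]] := hd 1 ltr01.
have [f [_ fS]] := dependent_choice step (exist _ s0 (conj ts0 v0)).
pose s n := sval (f n).
have ts n : t < s n by case: (svalP (f n)).
have sS n : s n.+1 <= t + (s n - t) / 2 by exact: fS.
have sn n : s n - t <= (s 0%N - t) / 2 ^+ n.
  elim: n => [|n IH]; first by rewrite expr0 divr1.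
  have := sS n; rewrite exprS invfM mulrCA => h.
  have : (s n - t) / 2 <= ((s 0%N - t) / 2 ^+ n) / 2 by rewrite ler_pM2r.
  lra.
have [|||N hN] := @vl_sigma _ phi (fun n => A `&` slab u v t (s n)) (A `&` slab u v t t) hs.
- by move=> n; apply: ccpI => //; exact: ccl_slab.
- move=> n x [Ax]; rewrite /slab /= => /andP[h1 h2]; split => //; apply/andP; split => //.
  have := sS n; have := ts n; lra.
- apply/seteqP; split => x /=.
    move=> hx; have [Ax _] := hx 0%N I; split => //; rewrite /slab /=.
    have hh n : t <= u * cx x + v * cy x <= s n by have [] := hx n I.
    have /andP[-> _] /= := hh 0%N; rewrite leNgt; apply/negP => lt.
    set y := u * cx x + v * cy x in hh lt *.
    have e0 : 0 < (y - t) / (s 0%N - t) by apply: divr_gt0; have := ts 0%N; lra.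
    have [N _ /(_ N (leqnn N))] := near_infty_natSinv_expn_lt (PosNum e0).
    rewrite /= div1r ltr_pdivlMr; last by have := ts 0%N; lra.
    have /andP[_] := hh N; have := sn N; rewrite [_ / 2 ^+ N]mulrC; lra.
  move=> [Ax]; rewrite /slab /= => /andP[h1 h2] n _; split => //; apply/andP; split => //.
  exact: le_trans h2 (ltW (ts n)).
have := hN N (leqnn N); rewrite h0; by case: (svalP (f N)).
Qed.

End Vanishing.

Lemma vl_slabs0 phi A u v : K2_valuation phi -> K2_sigma_continuous phi -> ccp A ->
  (forall t, vl phi (A `&` slab u v t t) = 0) -> vl phi A = 0.
Proof.
move=> hv hs cA h0.
have [r [r0 Ar]] := box_bounded cA.1.
pose B := (`|u| + `|v|) * r.
have AB : A `<=` slab u v (- B) B.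
  move=> x /Ar [hx hy]; rewrite /slab /= -ler_norml.
  apply: le_trans (ler_normD _ _) _; rewrite !normrM /B mulrDl.
  by apply: lerD; apply: ler_wpM2l => //; rewrite ler_norml.
rewrite -(setIidl AB); apply: (@interval_induction R (fun a b => vl phi (A `&` slab u v a b) = 0)).
- move=> a b c ab bc h1 h2.
  rewrite (@vl_split _ phi (A `&` slab u v a c) (slab u v a b) (slab u v b c))//.
  + rewrite slabI// slab_sub// slab_sub// slab_sub//.
    by rewrite h1 h2 h0.
  + by apply: ccpI => //; exact: ccl_slab.
  + exact: ccl_slab.
  + exact: ccl_slab.
  + move=> x [Ax]; rewrite /slab /= => h.
    have [|] := lerP (u * cx x + v * cy x) b; [left|right]; lra.
- move=> t; have [|d d0 hd] := @vl_slab_right phi hs A (- u) (- v) cA (- t).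
    by rewrite slab_opp opprK.
  exists d => // s s1 s2; rewrite -[t]opprK -[s]opprK -slab_opp.
  by apply: hd; lra.
- by move=> t; exact: vl_slab_right.
- by rewrite ge0_cp // /B; apply: mulr_ge0; [apply: addr_ge0|lra].
Qed.

Lemma K2_valuationB phi psi : K2_valuation phi -> K2_valuation psi ->
  K2_valuation (fun K => phi K - psi K).
Proof.
move=> [h1 h2] [h3 h4]; split; first by rewrite h1 h3 subr0.
move=> K L U E; have := h2 K L U E; have := h4 K L U E; lia.
Qed.

Lemma K2_sigma_continuousB phi psi : K2_sigma_continuous phi ->
  K2_sigma_continuous psi -> K2_sigma_continuous (fun K => phi K - psi K).
Proof.
move=> h1 h2 A K dA AK; rewrite rmorphB /=.
have -> : (fun n => (phi (A n) - psi (A n))%:~R : R) =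
   (fun n => (phi (A n))%:~R) \- (fun n => (psi (A n))%:~R).
  by apply/funext => n; rewrite rmorphB.
by apply: cvgB; [exact: h1|exact: h2].
Qed.

Lemma valuation_eq phi psi : K2_valuation phi -> K2_valuation psi ->
  K2_sigma_continuous phi -> K2_sigma_continuous psi ->
  (forall x, vl phi [set x] = vl psi [set x]) -> forall K, phi K = psi K.
Proof.
move=> v1 v2 s1 s2 hx K; apply/eqP; rewrite -subr_eq0; apply/eqP.
pose del K := phi K - psi K.
have hv : K2_valuation del by exact: K2_valuationB.
have hs : K2_sigma_continuous del by exact: K2_sigma_continuousB.
rewrite -[LHS]/(del K) -vl_body; have cK := ccp_body K.
apply: (@vl_slabs0 del K 1 0) => // t.
have cKt : ccp (K `&` slab 1 0 t t) by apply: ccpI => //; exact: ccl_slab.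
apply: (@vl_slabs0 del _ 0 1) => // s.
have [->|/set0P[x Kx]] := eqVneq (K `&` slab 1 0 t t `&` slab 0 1 s s) set0.
  exact: vl0.
have E y : (K `&` slab 1 0 t t `&` slab 0 1 s s) y -> y = pt t s.
  move=> [[_ h1] h2]; apply: rV2_eq; rewrite ?cx_pt ?cy_pt.
    by move: h1; rewrite /slab /=; lra.
  by move: h2; rewrite /slab /=; lra.
rewrite (_ : _ `&` _ = [set x]); first by rewrite /vl /del -![phi _]/(vl phi _) hx subrr.
by rewrite (E x Kx); apply/seteqP; split=> [y /E //|y ->]; rewrite -(E x Kx).
Qed.

End Uniqueness.

(** * Local polyconvexity of the point values *)

Section Trapezoid.
Variable R : realType.
Local Notation V := 'rV[R]_2.
Implicit Types (phi : K2 R -> int) (A B : set V) (l : R -> R).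

(* The sign [e] selects whether the region lies above ([e = 1]) or, after the
   reflection [y |-> - y], below ([e = -1]) the graph. *)
Definition trap (e M p q : R) l : set V :=
  [set x | p <= cx x <= q /\ l (cx x) <= e * cy x <= M].

Lemma ccl_trap e M p q l : bent l -> ccl (trap e M p q l).
Proof.
move=> [[[a b] [a' b']] /= hl].
rewrite (_ : trap e M p q l = ([set x | p <= cx x] `&` [set x | cx x <= q]) `&`
   ([set x | e * cy x <= M] `&`
   ([set x | b * cx x + (- e) * cy x <= - a] `&` [set x | b' * cx x + (- e) * cy x <= - a']))).
  by repeat apply: cclI; first [exact: ccl_ge_cx|exact: ccl_le_cx|exact: ccl_le_cy|exact: ccl_half].
apply/seteqP; split => x; rewrite /trap /= hl ge_max.
  move=> [/andP[h1 h2] /andP[/andP[h3 h4] h5]]; do !split => //; lra.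
by move=> [[h1 h2] [h3 [h4 h5]]]; split; [rewrite h1 h2|apply/andP; split => //; apply/andP;
  split; lra].
Qed.

Lemma ccp_trap e M p q l : e != 0 -> bent l -> ccp (trap e M p q l).
Proof.
move=> e0 bl; have [[[a b] [a' b']] /= hl] := bl.
pose B := `|a| + `|b| * (`|p| + `|q|).
have lB u : p <= u <= q -> - B <= l u.
  move=> /andP[pu uq]; rewrite hl le_max; apply/orP; left.
  have ub : `|u| <= `|p| + `|q|.
    by rewrite ler_norml; have := ler_norm p; have := ler_norm q; have := ler_norm (- p);
      have := ler_norm (- q); rewrite !normrN; lra.
  have : `|b * u| <= `|b| * (`|p| + `|q|) by rewrite normrM ler_wpM2l.
  have := ler_norm (- a); have := ler_norm (- (b * u)); rewrite !normrN /B; lra.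
pose D := (`|M| + B) / `|e|.
have B0 : 0 <= B by rewrite /B addr_ge0// mulr_ge0// addr_ge0.
apply: (@ccp_sub _ _ p q (- D) D); first exact: ccl_trap.
move=> x [h1 /andP[h2 h3]]; split => //; rewrite -ler_norml /D ler_pdivlMr ?normr_gt0//.
rewrite -normrM mulrC ler_norml; have := lB _ h1; have := ler_norm M; have := normr_ge0 M; lra.
Qed.

Lemma trap_box m M p q : trap 1 M p q (fun=> m) = box p q m M.
Proof. by apply/seteqP; split => x; rewrite /trap /box /= mul1r. Qed.

Lemma trap_box_opp m M p q : trap (-1) (- m) p q (fun=> - M) = box p q m M.
Proof. by apply/seteqP; split => x; rewrite /trap /box /= mulN1r !lerN2 => -[-> /andP[-> ->]]. Qed.

Section Phi.
Variable phi : K2 R -> int.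
Hypotheses (hv : K2_valuation phi) (hm : K2_monotone phi) (hs : K2_sigma_continuous phi).
Variables (e M : R).
Hypothesis e0 : e != 0.
Local Notation w := (fun p q l => vl phi (trap e M p q l)).

Lemma vl_trap_split l p r q : bent l -> p <= r -> r <= q ->
  w p q l = w p r l + w r q l - w r r l.
Proof.
move=> bl pr rq /=.
rewrite (@vl_split _ phi _ [set x | cx x <= r] [set x | r <= cx x] hv (ccp_trap M p q e0 bl)).
- congr (vl phi _ + vl phi _ - vl phi _); apply/seteqP; split => x; rewrite /trap /=.
  + by move=> [[/andP[h1 h2] h3] h4]; rewrite h1 h4 h3.
  + by move=> [/andP[h1 h2] h3]; rewrite h1 h3 (le_trans h2).
  + by move=> [[/andP[h1 h2] h3] h4]; rewrite h2 h4 h3.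
  + by move=> [/andP[h1 h2] h3]; rewrite h2 h3 (le_trans pr).
  + by move=> [[_ ->] [-> ->]].
  + by move=> [/andP[h1 h2] h3]; rewrite h3 h1 h2 (le_trans pr)// (le_trans h2).
- exact: ccl_le_cx.
- exact: ccl_ge_cx.
- by move=> x _; have [|/ltW] := lerP (cx x) r; [left|right].
Qed.

Lemma vl_trap_mono l l' p q p' q' : bent l -> bent l' -> p <= p' -> q' <= q ->
  (forall t, p' <= t -> t <= q' -> l t <= l' t) -> w p' q' l' <= w p q l.
Proof.
move=> bl bl' pp qq ll /=; apply: vl_mono => //; [exact: ccp_trap|exact: ccp_trap|].
move=> x [/andP[h1 h2] /andP[h3 h4]]; split; apply/andP; split => //.
- exact: le_trans h1.
- exact: le_trans qq.
- by apply: le_trans h3; exact: ll.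
Qed.

(** The enlargements with [d = 1/(n+1)] decrease to the segment, and their integer values are
    eventually equal to its value. *)
Lemma vl_trap_loc t y : exists2 d, 0 < d &
  w (t - d) (t + d) (fun=> y - d) = w t t (fun=> y).
Proof.
pose T (d : R) := trap e M (t - d) (t + d) (fun=> y - d).
have [|||N /(_ N (leqnn N)) hN] := @vl_sigma _ phi (fun n => T n.+1%:R^-1) (trap e M t t (fun=>
  y)) hs.
- by move=> n; apply: ccp_trap => //; exact: bent_cst.
- move=> n x; rewrite /T /trap /=.
  have : n.+2%:R^-1 <= n.+1%:R^-1 :> R by rewrite lef_pV2 ?posrE// ler_nat.
  move: (_^-1) (_^-1) => a b; lra.
- apply/seteqP; split => x; rewrite /T /trap /=.
    move=> h.
    have inf_le (z z' : R) : (forall n, z <= z' + n.+1%:R^-1) -> z <= z'.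
      move=> hz; rewrite leNgt; apply/negP => zz.
      have zz' : 0 < z - z' by lra.
      have [N _ /(_ N (leqnn N))] := near_infty_natSinv_lt (PosNum zz').
      by move: (hz N) => /=; move: (_^-1) => a; lra.
    have [_ /andP[_ hM]] := h 0%N I.
    split; apply/andP; split=> //; apply: inf_le => n;
      by have [/andP[h1 h2] /andP[h3 h4]] := h n I; move: (_^-1) h1 h2 h3 => a h1 h2 h3; lra.
  move=> [/andP[h1 h2] /andP[h3 h4]] n _.
  have : 0 < n.+1%:R^-1 :> R by rewrite invr_gt0.
  move: (_^-1) => a a0; split; apply/andP; split; lra.
exists N.+1%:R^-1 => //; by rewrite invr_gt0.
Qed.

Lemma vl_trap_top t y : M < y -> w t t (fun=> y) = 0.
Proof.
move=> My /=; rewrite (_ : trap _ _ _ _ _ = set0) ?vl0//.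
by apply/seteqP; split => x //; rewrite /trap /=; lra.
Qed.

Lemma tops_vl m al be c :
  (forall p q, al < p -> p <= q -> q < be -> w p q (fun=> m) = c%:Z) ->
  tops w m M al be c.
Proof.
move=> hst; split => //.
- exact: vl_trap_split.
- exact: vl_trap_mono.
- exact: vl_trap_loc.
- exact: vl_trap_top.
Qed.

Lemma vl_line_tops m t : exists c (b : 'I_c -> R), w t t (fun=> m) = c%:Z /\
  forall y, m <= y -> w t t (fun=> y) = #|[set j | y <= b j]%SET|%:Z.
Proof.
have anti y y' : y <= y' -> w t t (fun=> y') <= w t t (fun=> y).
  by move=> yy; apply: vl_trap_mono => //; exact: bent_cst.
have : 0 <= w t t (fun=> m).
  rewrite -(@vl_trap_top t (Num.max (M + 1) (m + 1))) ?lt_max ?ltrDl ?ltr01//.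
  by apply: anti; rewrite le_max lerDl ler01 orbT.
case E : (w t t (fun=> m)) => [c|//] _.
exists c, (fun j => jump (fun y => w t t (fun=> y)) m j); split=> // y my.
apply: (@card_jump _ (fun y => w t t (fun=> y)) m M c) => //.
- by move=> z; exact: vl_trap_top.
- move=> z; have [d d0 hd] := vl_trap_loc t z; exists d => //; rewrite -hd.
  by apply: vl_trap_mono; [exact: bent_cst|exact: bent_cst|lra|lra|].
Qed.

End Phi.
End Trapezoid.

Section Polyconvex.
Variable R : realType.
Local Notation V := 'rV[R]_2.
Implicit Types (f g : V -> int) (A B C : set V) (P M : seq (set V)).

Lemma ccl_true : ccl [set _ : V | true].
Proof.
rewrite (_ : mkset _ = setT); last by apply/seteqP; split.
by split; [exact: closedT|apply/convex_setP].
Qed.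

Definition polyconvex f := exists P M,
  {in P ++ M, forall C, ccp C} /\
  forall x, f x = \sum_(C <- P) (\1_C x : int) - \sum_(C <- M) (\1_C x : int).

Lemma eq_polyconvex f g : f =1 g -> polyconvex f -> polyconvex g.
Proof. by move=> fg [P [M [h E]]]; exists P, M; split => // x; rewrite -fg. Qed.

Lemma polyconvex_indic C : ccp C -> polyconvex (\1_C).
Proof.
move=> cC; exists [:: C], [::]; split=> [D|x].
  by rewrite inE => /eqP ->.
by rewrite big_seq1 big_nil subr0.
Qed.

Lemma polyconvexN f : polyconvex f -> polyconvex (fun x => - f x).
Proof.
move=> [P [M [h E]]]; exists M, P; split=> [C|x]; last by rewrite E opprB.
by rewrite mem_cat orbC -mem_cat; exact: h.
Qed.

Lemma polyconvexD f g : polyconvex f -> polyconvex g -> polyconvex (fun x => f x + g x).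
Proof.
move=> [P [M [h E]]] [P' [M' [h' E']]]; exists (P ++ P'), (M ++ M'); split=> [C|x].
  rewrite !mem_cat -orbA => /or4P[] CP.
  - by apply: h; rewrite mem_cat CP.
  - by apply: h'; rewrite mem_cat CP.
  - by apply: h; rewrite mem_cat CP orbT.
  - by apply: h'; rewrite mem_cat CP orbT.
by rewrite !big_cat /= E E'; ring.
Qed.

Lemma polyconvexB f g : polyconvex f -> polyconvex g -> polyconvex (fun x => f x - g x).
Proof. by move=> hf hg; apply: polyconvexD => //; exact: polyconvexN. Qed.

Lemma polyconvex0 : polyconvex (fun=> 0).
Proof. by exists [::], [::]; split => // x; rewrite !big_nil subrr. Qed.

Lemma polyconvex_sum n (F : 'I_n -> V -> int) : (forall i, polyconvex (F i)) ->
  polyconvex (fun x => \sum_(i < n) F i x).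
Proof.
elim: n F => [|n IH] F hF.
  by apply: eq_polyconvex polyconvex0 => x; rewrite big_ord0.
apply: eq_polyconvex (polyconvexD (hF ord0) (IH (fun i => F (lift ord0 i)) _)) => // x.
by rewrite big_ord_recl.
Qed.

Lemma mem_mkset (p : V -> bool) x : (x \in [set y | p y]) = p x.
Proof. by apply/idP/idP => [/set_mem|h] //; exact/mem_set. Qed.

Lemma indicI_mul A B x : (\1_(A `&` B) x : int) = \1_A x * \1_B x.
Proof. by rewrite !indicE in_setI; case: (_ \in _); case: (_ \in _). Qed.

Lemma polyconvex_restr f B : polyconvex f -> ccl B -> polyconvex (fun x => f x * \1_B x).
Proof.
move=> [P [M [h E]]] cB.
exists [seq C `&` B | C <- P], [seq C `&` B | C <- M]; split=> [C|x].
  rewrite -map_cat => /mapP[D /h cD ->]; exact: ccpI.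
rewrite E mulrBl !big_map !big_distrl /=.
by congr (_ - _); apply: eq_bigr => C _; rewrite indicI_mul.
Qed.

Lemma polyconvex_card n (F : 'I_n -> V -> bool) B : ccp B ->
  (forall j, ccl [set x | F j x]) ->
  polyconvex (fun x => #|[set j | F j x]%SET|%:Z * \1_B x).
Proof.
move=> cB cF; apply: eq_polyconvex (@polyconvex_sum n (fun j => \1_(B `&` [set x | F j x])) _).
  move=> x; apply/esym; rewrite -sum1_card -natz natr_sum big_mkcond big_distrl /=.
  apply: eq_bigr => j _; rewrite indicI_mul mulrC inE [\1_[set _ | _] _]indicE mem_mkset.
  by case: (F j x).
by move=> j; apply: polyconvex_indic; exact: ccpI.
Qed.

(** Each failure of constancy raises the value by at least one while shrinking [d], and [k] bounds
    the values. *)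
Lemma nonincreasing_int_right (h : R -> int) (k : int) d : 0 < d ->
  (forall r, 0 < r -> r <= d -> h r <= k) ->
  (forall r r', 0 < r -> r <= r' -> r' <= d -> h r' <= h r) ->
  exists2 d', 0 < d' <= d & forall r, 0 < r -> r <= d' -> h r = h d'.
Proof.
have [N] := ubnP `|k - h d|%N; elim: N d => // N IH d hN d0 hk mono.
have [//|] := pselect (forall r, 0 < r -> r <= d -> h r = h d).
  by move=> h'; exists d => //; rewrite d0 lexx.
move=> /existsNP[r /not_implyP[r0 /not_implyP[rd hr]]].
have hkd := hk d d0 (lexx d).
have hkr := hk r r0 rd.
have hrd := mono r d r0 rd (lexx d).
have [||||d' /andP[d'0 d'r] hd'] := IH r.
- by clear -hN hkd hkr hrd hr; lia.
- exact: r0.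
- by move=> u u0 ur; apply: hk => //; exact: le_trans rd.
- by move=> u v u0 uv vr; apply: mono => //; exact: le_trans rd.
by exists d' => //; rewrite d'0 (le_trans d'r).
Qed.

Section Phi.
Variable phi : K2 R -> int.
Hypotheses (hv : K2_valuation phi) (hm : K2_monotone phi) (hs : K2_sigma_continuous phi).
Local Notation fx := (fun x => vl phi [set x]).

Lemma vl_point x (m M : R) : m <= cy x <= M ->
  fx x = vl phi (trap 1 M (cx x) (cx x) (fun=> cy x)) +
         vl phi (trap (-1) (- m) (cx x) (cx x) (fun=> - cy x)) -
         vl phi (box (cx x) (cx x) m M).
Proof.
move=> /andP[my yM]; set t := cx x; set y := cy x in my yM *.
rewrite (@vl_split _ phi (box t t m M) [set z | y <= 1 * cy z] [set z | - y <= (-1) * cy z]) //;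
  [|exact: ccp_box|exact: ccl_ge_cy|exact: ccl_ge_cy|].
  have -> : box t t m M `&` [set z | y <= 1 * cy z] = trap 1 M t t (fun=> y).
    apply/seteqP; split => z; rewrite /trap /box /=; first by move=> [[h1 /andP[_ h2]] h3]; split
      => //; apply/andP; split; lra.
    by move=> [h0 /andP[h1 h2]]; split; [split => //; apply/andP; split; lra|].
  have -> : box t t m M `&` [set z | - y <= (-1) * cy z] = trap (-1) (- m) t t (fun=> - y).
    apply/seteqP; split => z; rewrite /trap /box /=; first by move=> [[h1 /andP[h h']] h''];
      split => //; apply/andP; split; lra.
    by move=> [h0 /andP[h1 h2]]; split; [split => //; apply/andP; split; lra|].
  have -> : box t t m M `&` ([set z | y <= 1 * cy z] `&` [set z | - y <= (-1) * cy z]) = [set x].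
    apply/seteqP; split => z; rewrite /box /=.
      by move=> [[/andP[h1 h2] _] [h3 h4]]; apply: rV2_eq; rewrite -/t -/y; lra.
    by move=> ->; rewrite -/t -/y; split; [split; apply/andP; split; lra|split; lra].
  lra.
by move=> z _ /=; have [h|h] := lerP y (cy z); [left|right]; lra.
Qed.

Lemma polyconvex_line (t m M : R) : polyconvex (fun x => fx x * \1_(box t t m M) x).
Proof.
have [c [b [bm hb]]] := vl_line_tops hv hm hs M (oner_neq0 R) m t.
have n1 : (-1 : R) != 0 by rewrite oppr_eq0 oner_neq0.
have [c' [b' [bM hb']]] := vl_line_tops hv hm hs (- m) n1 (- M) t.
have cB := ccp_box t t m M.
have h1 := @polyconvex_card c (fun j x => 1 * cy x <= b j) _ cB (fun j => ccl_le_cy _ _).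
have h2 := @polyconvex_card c' (fun j x => (-1) * cy x <= b' j) _ cB (fun j => ccl_le_cy _ _).
have h3 := @polyconvex_card c (fun j x => true) _ cB (fun j => ccl_true).
apply: eq_polyconvex (polyconvexB (polyconvexD h1 h2) h3).
move=> x; rewrite -mulrDl -mulrBl indicE.
have [/set_mem [] |] := boolP (x \in box t t m M); last by rewrite !mulr0.
move=> tx yx; rewrite !mulr1.
have xt : cx x = t by lra.
rewrite (@vl_point x m M)// xt hb ?hb'; [|lra|lra].
rewrite trap_box in bm; rewrite bm; congr (_ + _ - _); congr Posz.
- by apply: eq_card => j; rewrite !inE mul1r.
- by apply: eq_card => j; rewrite !inE mulN1r.
- by rewrite -[RHS]card_ord; apply: eq_card => j; rewrite !inE.
Qed.

(* Up to a constant, the value at a point is the value of the vertical segment above it plus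
   that of the segment below it; each counts hypographs of concave functions, written as
   intersections of half-planes. The line [cx x = e] is treated apart. *)
Lemma polyconvex_strip (al be p q e m M : R) c :
  (forall p q, al < p -> p <= q -> q < be -> vl phi (box p q m M) = c%:Z) ->
  (forall t, p <= t -> t <= q -> t != e -> al < t < be) ->
  polyconvex (fun x => fx x * \1_(box p q m M) x).
Proof.
move=> hst he.
have n1 : (-1 : R) != 0 by rewrite oppr_eq0 oner_neq0.
have [|g [s [gs hg]]] := tops_decomposition (tops_vl hv hm hs (M := M) (oner_neq0 R) (m := m) (al
  := al) (be := be) (c := c) _).
  by move=> u v uv; rewrite trap_box; exact: hst.
(* After the reflection the bottom is [- M] and the ceiling [- m]; the full boxes are the same,
   hence so is [c]. *)
have [|g' [s' [gs' hg']]] := tops_decomposition (tops_vl hv hm hs (M := - m) n1 (m := - M) (al :=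
  al) (be := be) (c := c) _).
  by move=> u v uv; rewrite trap_box_opp; exact: hst.
(* Lying below all tangent lines is a closed convex condition whatever [g] and [s] are; over []al,
   be[] it describes the hypograph of [g j]. *)
pose F (d : R) (g s : 'I_c -> R -> R) j (x : V) :=
  `[< forall u, al < u < be -> d * cy x <= line (g j u) (s j u) u (cx x) >].
have cF d (g0 s0 : 'I_c -> R -> R) j : ccl [set x | F d g0 s0 j x].
  rewrite (_ : mkset _ = \bigcap_(u in [set u | al < u < be])
     [set x | - s0 j u * cx x + d * cy x <= g0 j u - s0 j u * u]).
    by apply: ccl_bigI => u _; exact: ccl_half.
  apply/seteqP; split=> x /=; first by move=> /asboolP h u /= /h; rewrite /line; lra.
  by move=> h; apply/asboolP => u /h /=; rewrite /line; lra.
have cB := ccp_box p q m M.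
pose D (x : V) : int := #|[set j | F 1 g s j x]%SET|%:Z + #|[set j | F (-1) g' s' j x]%SET|%:Z -
  c%:Z.
have pD : polyconvex (fun x => D x * \1_(box p q m M) x).
  apply: eq_polyconvex (polyconvexB (polyconvexD (@polyconvex_card c (F 1 g s) _ cB (cF _ _ _))
    (@polyconvex_card c (F (-1) g' s') _ cB (cF _ _ _)))
    (@polyconvex_card c (fun _ _ => true) _ cB (fun j => ccl_true))).
  move=> x; rewrite -mulrDl -mulrBl /D; congr ((_ - Posz _) * _).
  by rewrite -[RHS]card_ord; apply: eq_card => j; rewrite !inE.
have cE : ccl [set x : V | 1 * cx x + 0 * cy x <= e] by exact: ccl_half.
have cE' : ccl [set x : V | (-1) * cx x + 0 * cy x <= - e] by exact: ccl_half.
(* [D] may be wrong at the abscissa [e]: there [p2] takes it away and [p1] puts back the true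
   values. *)
have p1 := polyconvex_restr (polyconvex_line e m M) (ccl_box p q m M).
have p2 := polyconvex_restr pD (ccl_box e e m M).
apply: eq_polyconvex (polyconvexB (polyconvexD pD p1) p2) => x.
have [/set_mem [pq mM]|xB] := boolP (x \in box p q m M); last first.
  by rewrite !indicE (negPf xB) !mulr0 !mul0r addr0 subr0.
have [xe|xe] := eqVneq (cx x) e.
  have xE : x \in box e e m M by apply/mem_set; split => //; rewrite xe lexx.
  by rewrite !indicE xE !mulr1; ring.
have xE : x \in box e e m M = false.
  by apply/negP => /set_mem[h _]; move/eqP: xe; apply; apply/eqP; rewrite eq_le andbC.
have xB : x \in box p q m M by apply/mem_set.
rewrite !indicE xE xB !mulr0 !mul0r !mulr1 addr0 subr0.
have xab : al < cx x < be by case/andP: pq => h1 h2; exact: he.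
have hD d (g0 s0 : 'I_c -> R -> R) j : (forall i t u, al < t < be -> al < u < be -> g0 i u <=
  line (g0 i t) (s0 i t) t u) ->
    F d g0 s0 j x = (d * cy x <= g0 j (cx x)).
  move=> h; apply/asboolP/idP => [/(_ _ xab)|h' u uab].
    by rewrite /line subrr mulr0 addr0.
  by apply: le_trans h' _; exact: h.
rewrite (vl_point mM) /D; congr (_ + _ - _).
- rewrite -[LHS]/(Posz _) -/(top_count (fun p q l => vl phi (trap 1 M p q l)) (cx x) (cy x))
  hg//; last by case/andP: mM.
  by congr Posz; apply: eq_card => j; rewrite !inE hD// mul1r.
- rewrite -/(top_count (fun p q l => vl phi (trap (-1) (-m) p q l)) (cx x) (- cy x)) hg'//; last
  by case/andP: mM; rewrite lerN2.
  by congr Posz; apply: eq_card => j; rewrite !inE hD// mulN1r.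
- by case/andP: xab => h1 h2; apply/esym; exact: hst.
Qed.

Lemma vl_box_loc (t m M : R) : exists2 d, 0 < d & forall a b, t - d <= a -> a <= t ->
  t <= b -> b <= t + d -> vl phi (box a b m M) = vl phi (box t t m M).
Proof.
have [d d0 hd] := vl_trap_loc hs M (oner_neq0 R) t m.
exists d => // a b a1 a2 b1 b2; apply/eqP; rewrite eq_le; apply/andP; split.
  rewrite -[X in _ <= vl phi X]trap_box -hd; apply: vl_mono => //.
  - exact: ccp_box.
  - by apply: ccp_trap; [exact: oner_neq0|exact: bent_cst].
  by move=> x [/andP[h1 h2] /andP[h3 h4]]; split; rewrite ?mul1r; apply/andP; split; lra.
apply: vl_mono => //; [exact: ccp_box|exact: ccp_box|].
by move=> x [/andP[h1 h2] h3]; split=> //; apply/andP; split; lra.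
Qed.

Lemma vl_box_split (a b c m M : R) : a <= b -> b <= c ->
  vl phi (box a c m M) = vl phi (box a b m M) + vl phi (box b c m M) - vl phi (box b b m M).
Proof.
move=> ab bc; rewrite -!trap_box.
by apply: (vl_trap_split hv M (oner_neq0 R)) => //; exact: bent_cst.
Qed.

Lemma vl_box_mono (a b a' b' m M : R) : a <= a' -> b' <= b ->
  vl phi (box a' b' m M) <= vl phi (box a b m M).
Proof.
move=> aa bb; apply: vl_mono => //; [exact: ccp_box|exact: ccp_box|].
by move=> x [/andP[h1 h2] h3]; split => //; apply/andP; split; lra.
Qed.

Lemma vl_box_ge0 (a b m M : R) : 0 <= vl phi (box a b m M).
Proof. by rewrite -(vl0 hv); apply: vl_mono => //; [exact: ccp_set0|exact: ccp_box]. Qed.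

Lemma polyconvex_right (t m M : R) : exists2 d, 0 < d & forall s, t <= s -> s <= t + d ->
  polyconvex (fun x => fx x * \1_(box t s m M) x).
Proof.
have [d d0 hd] := vl_box_loc t m M.
pose h r := vl phi (box (t + r) (t + r) m M).
(* The boxes over [[t, t + r]] and [[t, t + r']] have equal values, so the split at [t + r] gives
   the box between [t + r] and [t + r'] the value of its section nearest to [t]. Hence [h] is
   nonincreasing. *)
have hE r r' : 0 < r -> r <= r' -> r' <= d -> vl phi (box (t + r) (t + r') m M) = h r.
  move=> r0 rr rd; have := @vl_box_split t (t + r) (t + r') m M ltac:(lra) ltac:(lra).
  rewrite (hd t (t + r')) ?(hd t (t + r)); [rewrite /h; lia|lra..].
have [|||d' /andP[d'0 d'd] hd'] := @nonincreasing_int_right h (vl phi (box t t m M)) d.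
- exact: d0.
- move=> r r0 rd; rewrite -(hd t (t + d)); [|lra..].
  by apply: vl_box_mono; lra.
- by move=> r r' r0 rr rd; rewrite -(hE r r')//; apply: vl_box_mono; lra.
have := vl_box_ge0 (t + d') (t + d') m M; rewrite -/(h d').
case hc : (h d') => [c|//] _.
(* The strip is []t, t + d'[]; half of [d'] keeps [s] inside it, and [t] is the exceptional
   abscissa. *)
exists (d' / 2); first lra.
move=> s ts sd; apply: (@polyconvex_strip t (t + d') t s t m M c).
  move=> p q tp pq qd; rewrite -hc -(hd' (p - t)) ?hE; [|lra..].
  rewrite -(hE (p - t) (q - t)); [|lra..].
  by congr (vl phi (box _ _ _ _)); lra.
by move=> u tu us ut; rewrite lt_neqAle eq_sym ut tu /=; lra.
Qed.

Lemma polyconvex_left (t m M : R) : exists2 d, 0 < d & forall s, t - d <= s -> s <= t ->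
  polyconvex (fun x => fx x * \1_(box s t m M) x).
Proof.
have [d d0 hd] := vl_box_loc t m M.
pose h r := vl phi (box (t - r) (t - r) m M).
have hE r r' : 0 < r -> r <= r' -> r' <= d -> vl phi (box (t - r') (t - r) m M) = h r.
  move=> r0 rr rd; have := @vl_box_split (t - r') (t - r) t m M ltac:(lra) ltac:(lra).
  rewrite (hd (t - r') t) ?(hd (t - r) t); [rewrite /h; set A := vl phi (box _ (t - r) _ _); set
    B := vl phi (box (t - r) _ _ _); lia|lra..].
have [|||d' /andP[d'0 d'd] hd'] := @nonincreasing_int_right h (vl phi (box t t m M)) d.
- exact: d0.
- move=> r r0 rd; rewrite -(hd (t - d) t); [|lra..].
  by apply: vl_box_mono; lra.
- by move=> r r' r0 rr rd; rewrite -(hE r r')//; apply: vl_box_mono; lra.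
have := vl_box_ge0 (t - d') (t - d') m M; rewrite -/(h d').
case hc : (h d') => [c|//] _.
exists (d' / 2); first lra.
move=> s ts sd; apply: (@polyconvex_strip (t - d') t s t t m M c).
  move=> p q tp pq qd; rewrite -hc -(hd' (t - q)) ?hE; [|lra..].
  rewrite -(hE (t - q) (t - p)); [|lra..].
  by congr (vl phi (box _ _ _ _)); lra.
by move=> u tu us ut; rewrite [u < t]lt_neqAle ut us /= andbT; lra.
Qed.

Lemma polyconvex_box (a b m M : R) : a <= b ->
  polyconvex (fun x => fx x * \1_(box a b m M) x).
Proof.
apply: (@interval_induction R (fun a b => polyconvex (fun x => fx x * \1_(box a b m M) x))).
- move=> {}a {}b c ab bc p1 p2.
  apply: eq_polyconvex (polyconvexB (polyconvexD p1 p2) (polyconvex_line b m M)) => x.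
  rewrite -mulrDr -mulrBr; congr (_ * _); rewrite !indicE.
  have E u v : (x \in box u v m M) = ((u <= cx x <= v) && (m <= cy x <= M)).
    by apply/idP/andP => [/set_mem[]//|[h1 h2]]; apply/mem_set.
  rewrite !E; case: (m <= cy x <= M); rewrite ?andbF ?andbT ?addr0 ?subr0//.
  have [h1|h1] := leP a (cx x); have [h2|h2] := leP (cx x) b;
    have [h3|h3] := leP b (cx x); have [h4|h4] := leP (cx x) c; rewrite /=
      ?(addr0,add0r,subr0,addrK,subrr)//; exfalso; lra.
- by move=> t; exact: polyconvex_left.
- by move=> t; exact: polyconvex_right.
Qed.

End Phi.
End Polyconvex.

(** * Valuations defined by locally finite families *)

Section Families.
Variable R : realType.
Local Notation V := 'rV[R]_2.
Implicit Types (A B C : set V) (K L : K2 R) (F : set_family R).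

Lemma chi_neq0 A : A !=set0 -> chi A = 1.
Proof. by move=> /set0P; rewrite /chi; case: eqVneq. Qed.

Lemma chi_eq0 A : ~ (A !=set0) -> chi A = 0.
Proof. by move=> /set0P/negP/negPn/eqP ->; rewrite /chi eqxx. Qed.

Lemma chi_set0 : chi (@set0 V) = 0.
Proof. by rewrite /chi eqxx. Qed.

Lemma chi_point A x : chi ([set x] `&` A) = \1_A x.
Proof.
rewrite indicE; have [/set_mem Ax|xA] := boolP (x \in A).
  by rewrite chi_neq0//; exists x.
by rewrite chi_eq0// => -[y [-> /mem_set]]; rewrite (negPf xA).
Qed.

(* A segment inside [(K `|` L) `&` C] from [K] to [L] meets [K `&` L] by connectedness. *)
Lemma meet_convex_union A B C : ccp A -> ccp B -> ccl C -> convex_set (A `|` B) ->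
  (A `&` C) !=set0 -> (B `&` C) !=set0 -> (A `&` B `&` C) !=set0.
Proof.
move=> /ccp_ccl[clA _] /ccp_ccl[clB _] [_ /convex_setP vC] /convex_setP vAB [x [Ax Cx]] [y [By Cy]].
apply: contrapT => hn.
pose ga (t : R) : V := t *: x + (1 - t) *: y.
have cga : continuous ga.
  move=> t; apply: cvgD; apply: cvgZr_tmp.
    exact: cvg_id.
  by apply: cvgB; [exact: cvg_cst|exact: cvg_id].
have U t : t \in `[0, 1] -> (A `|` B) (ga t) /\ C (ga t).
  by rewrite in_itv /= => /andP[t0 t1]; split; [apply: vAB => //; [left|right]|apply: vC].
have cA : closed (ga @^-1` A) by apply: preimage_closed => // t _; exact: cga.
have cB : closed (ga @^-1` B) by apply: preimage_closed => // t _; exact: cga.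
have := @segment_connected R 0 1 (`[0, 1]%classic `&` ga @^-1` A).
have E : `[0, 1]%classic `&` ga @^-1` A = `[0, 1]%classic `&` ~` (ga @^-1` B).
  apply/seteqP; split => t [ti h]; split => //=.
    by move=> gB; apply: hn; exists (ga t); have [] := U t ti.
  by have [[]] := U t ti.
have ga1 : ga 1 = x by rewrite /ga subrr scale0r addr0 scale1r.
have ga0 : ga 0 = y by rewrite /ga subr0 scale0r add0r scale1r.
have n0 : (`[0, 1]%classic `&` ga @^-1` A) !=set0.
  by exists 1; split; rewrite /= ?in_itv/= ?ler01 ?lexx ?ga1.
move=> /(_ n0) h.
have : `[0, 1]%classic `&` ga @^-1` A = `[0, 1]%classic.
  by apply: h; [exists (~` (ga @^-1` B)) => //; exact: closed_openC|exists (ga @^-1` A)].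
move=> /seteqP[_ /(_ 0)] /= [|_]; first by rewrite in_itv /= lexx ler01.
by rewrite ga0 => Ay; apply: hn; exists y.
Qed.

Lemma chi_valuation A B C : ccp A -> ccp B -> ccl C -> convex_set (A `|` B) ->
  chi ((A `|` B) `&` C) + chi (A `&` B `&` C) = chi (A `&` C) + chi (B `&` C).
Proof.
move=> cA cB cC vAB; rewrite setIUl.
have [hA|hA] := pselect ((A `&` C) !=set0); have [hB|hB] := pselect ((B `&` C) !=set0).
- rewrite !chi_neq0//; first exact: meet_convex_union.
  by case: hA => x hx; exists x; left.
- rewrite (chi_neq0 hA) (chi_eq0 hB) chi_neq0 ?chi_eq0//.
    by move=> [x [[_ Bx] Cx]]; apply: hB; exists x.
  by case: hA => x hx; exists x; left.
- rewrite (chi_neq0 hB) (chi_eq0 hA) chi_neq0 ?chi_eq0//.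
    by move=> [x [[Ax _] Cx]]; apply: hA; exists x.
  by case: hB => x hx; exists x; right.
- rewrite !chi_eq0//.
    by move=> [x [[Ax _] Cx]]; apply: hA; exists x.
  by move=> [x [h|h]]; [apply: hA|apply: hB]; exists x.
Qed.

Lemma nested_neq0 (A : nat -> set V) : (forall n, compact (A n)) ->
  (forall n, A n.+1 `<=` A n) -> (forall n, A n !=set0) -> \bigcap_n A n !=set0.
Proof.
move=> cA dA nA.
have mono i j : (i <= j)%N -> A j `<=` A i.
  move=> /subnKC <-; elim: (j - i)%N => [|k IH]; first by rewrite addn0.
  by rewrite addnS; apply: subset_trans IH; exact: dA.
pose G : set_system V := filter_from setT A.
have GF : ProperFilter G.
  apply: filter_from_proper => [|i _]; last exact: nA.
  apply: filter_from_filter; first by exists 0%N.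
  move=> i j _ _; exists (maxn i j) => // x h.
  by split; apply: mono h; rewrite ?leq_maxl ?leq_maxr.
have [|x [_ cx]] := cA 0%N G GF; first by exists 0%N.
exists x => n _.
have : closed (A n) by apply: compact_closed => //; exact: norm_hausdorff.
by apply => U xU; apply: cx => //; exists n.
Qed.

Lemma chi_sigma (A : nat -> set V) B C : (forall n, ccp (A n)) ->
  (forall n, A n.+1 `<=` A n) -> \bigcap_n A n = B -> ccl C ->
  exists N, forall n, (N <= n)%N -> chi (A n `&` C) = chi (B `&` C).
Proof.
move=> cA dA AB cC.
have mono i j : (i <= j)%N -> A j `<=` A i.
  move=> /subnKC <-; elim: (j - i)%N => [|k IH]; first by rewrite addn0.
  by rewrite addnS; apply: subset_trans IH; exact: dA.
have [[x [Bx Cx]]|hB] := pselect ((B `&` C) !=set0).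
  exists 0%N => n _; rewrite !chi_neq0//; exists x; split => //.
  by move: Bx; rewrite -AB; apply.
have [N hN] : exists N, ~ ((A N `&` C) !=set0).
  apply/existsNP => h; apply: hB.
  have [|||x hx] := @nested_neq0 (fun n => A n `&` C).
  - by move=> n; have [] := ccpI (cA n) cC.
  - by move=> n x [Ax Cx]; split => //; exact: dA.
  - by [].
  by exists x; split; [rewrite -AB => n _; have [] := hx n I|have [] := hx 0%N I].
exists N => n Nn; rewrite !chi_eq0// => -[x [Ax Cx]]; apply: hN; exists x; split => //.
exact: mono Ax.
Qed.

Definition meeting F B : seq nat :=
  fset_set [set n | indices F n /\ (B `&` F n) !=set0].

Lemma meeting_sum F B (f : nat -> int) : locally_finite F -> ccp B ->
  (forall n, indices F n -> ~ ((B `&` F n) !=set0) -> f n = 0) ->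
  \sum_(n \in indices F) f n = \sum_(n <- meeting F B) f n.
Proof.
move=> lF cB f0; have := lF (K2of B); rewrite K2ofE// => fin.
rewrite /meeting -fsbig_finite//; apply/esym/fsbig_widen => [n [] //|n [nF nB] /=].
by apply: f0 => // h; apply: nB.
Qed.

Lemma meeting_indices F B n : locally_finite F -> ccp B -> n \in meeting F B -> indices F n.
Proof.
move=> lF cB; have := lF (K2of B); rewrite K2ofE// => fin.
by rewrite /meeting in_fset_set// => /set_mem[].
Qed.

Lemma meeting_chi F B A : locally_finite F -> ccp B -> A `<=` B ->
  \sum_(n \in indices F) chi (A `&` F n) = \sum_(n <- meeting F B) chi (A `&` F n).
Proof.
move=> lF cB AB; apply: meeting_sum => // n nF h; apply: chi_eq0 => -[x [Ax Fx]].
by apply: h; exists x; split => //; exact: AB.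
Qed.

Definition lf_family F := nonempty_closed_convex F /\ locally_finite F.

Lemma lf_ccl F n : lf_family F -> indices F n -> ccl (F n).
Proof. by move=> [h _] /h[_ ? ?]. Qed.

Definition family_valuation F K : int := \sum_(n \in indices F) chi (K `&` F n).

Lemma family_valuationP F : lf_family F -> K2_valuation (family_valuation F).
Proof.
move=> hF; have lF := hF.2; split=> [|K L U E].
  rewrite /family_valuation fsbig1// => n _.
  by rewrite (_ : K2_empty R `&` F n = set0) ?chi_set0// set0I.
have cU := ccp_body U.
have KU : K `<=` U by rewrite E; exact: subsetUl.
have LU : L `<=` U by rewrite E; exact: subsetUr.
(* The finite list of members that meet [U] serves for all four sums. *)
rewrite /family_valuation !(meeting_chi lF cU)//=; last by move=> x [/KU].
rewrite -!big_split /=; apply: eq_big_seq => n /(meeting_indices lF cU) nF.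
rewrite E; apply: chi_valuation; [exact: ccp_body|exact: ccp_body|exact: lf_ccl|].
by rewrite -E; exact: body_convex.
Qed.

Lemma cvg_int_eventually (u : nat -> int) (l : int) :
  (exists N, forall n, (N <= n)%N -> u n = l) -> (u n)%:~R @[n --> \oo] --> (l%:~R : R).
Proof.
move=> [N hN]; apply: cvg_near_cst; exists N => // n /= Nn.
by rewrite hN.
Qed.

Lemma all_eventually (T : eqType) (s : seq T) (P : T -> nat -> Prop) :
  {in s, forall i, exists N, forall n, (N <= n)%N -> P i n} ->
  exists N, forall n, (N <= n)%N -> {in s, forall i, P i n}.
Proof.
elim: s => [|i s IH] h; first by exists 0%N.
have [N1 h1] := h i (mem_head _ _).
have [|N2 h2] := IH; first by move=> j js; apply: h; rewrite inE js orbT.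
exists (maxn N1 N2) => n; rewrite geq_max => /andP[n1 n2] j; rewrite inE.
by move=> /orP[/eqP ->|js]; [exact: h1|exact: h2].
Qed.

Lemma family_sigma_continuous F : lf_family F -> K2_sigma_continuous (family_valuation F).
Proof.
move=> hF A K dA AK; have lF := hF.2; apply: cvg_int_eventually.
have c0 := ccp_body (A 0%N).
have A0 n : A n `<=` A 0%N.
  by elim: n => [|n IH] //; apply: subset_trans IH; exact: dA.
have [|N hN] := @all_eventually _ (meeting F (A 0%N))
   (fun i n => chi (A n `&` F i) = chi (K `&` F i)).
  move=> i /(meeting_indices lF c0) iF; apply: chi_sigma => //; last exact: lf_ccl.
  by move=> n; exact: ccp_body.
exists N => n Nn; rewrite /family_valuation !(meeting_chi lF c0)//.
  by apply: eq_big_seq => i iF; exact: hN.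
by rewrite -AK => x; apply.
Qed.

Section Pair.
Variables Cp Cm : set_family R.
Hypotheses (hp : lf_family Cp) (hm : lf_family Cm).

Lemma pair_valuationP : K2_valuation (pair_valuation Cp Cm).
Proof. by apply: K2_valuationB; exact: family_valuationP. Qed.

Lemma pair_sigma_continuous : K2_sigma_continuous (pair_valuation Cp Cm).
Proof. by apply: K2_sigma_continuousB; exact: family_sigma_continuous. Qed.

Lemma pair_point x : vl (pair_valuation Cp Cm) [set x] = pair_indicator Cp Cm x.
Proof.
rewrite /vl /pair_valuation /pair_indicator K2ofE; last exact: ccp_set1.
by congr (_ - _); apply: eq_fsbigr => n _; rewrite chi_point.
Qed.

End Pair.

Lemma pair_eq Cp Cm Dp Dm : lf_family Cp -> lf_family Cm -> lf_family Dp -> lf_family Dm ->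
  (forall K, pair_valuation Cp Cm K = pair_valuation Dp Dm K) <->
  (forall x, pair_indicator Cp Cm x = pair_indicator Dp Dm x).
Proof.
move=> h1 h2 h3 h4; split=> h.
  by move=> x; rewrite -!pair_point /vl h.
apply: valuation_eq => [||||x]; last by rewrite !pair_point.
- exact: pair_valuationP.
- exact: pair_valuationP.
- exact: pair_sigma_continuous.
- exact: pair_sigma_continuous.
Qed.

End Families.

(** * Admissibility and monotonicity *)

Section MonotoneAdmissible.
Variable R : realType.
Local Notation V := 'rV[R]_2.
Implicit Types (A B C : set V) (x y u : V).

Lemma all_small (T : eqType) (s : seq T) (P : T -> R -> Prop) :
  {in s, forall i, exists2 d, 0 < d & forall r, 0 < r -> r <= d -> P i r} ->
  exists2 d, 0 < d & forall r, 0 < r -> r <= d -> {in s, forall i, P i r}.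
Proof.
elim: s => [|i s IH] h; first by exists 1.
have [d1 d10 h1] := h i (mem_head _ _).
have [|d2 d20 h2] := IH; first by move=> j js; apply: h; rewrite inE js orbT.
exists (Num.min d1 d2); first by rewrite lt_min d10.
move=> r r0; rewrite le_min => /andP[r1 r2] j; rewrite inE.
by move=> /orP[/eqP ->|js]; [exact: h1|exact: h2].
Qed.

Definition sqbox x r := box (cx x - r) (cx x + r) (cy x - r) (cy x + r).

Lemma sqbox_center x r : 0 <= r -> sqbox x r x.
Proof. by move=> r0; split; apply/andP; split; lra. Qed.

Lemma closed_sqbox C x : closed C -> ~ C x ->
  exists2 d, 0 < d & forall r, 0 < r -> r <= d -> ~ ((sqbox x r `&` C) !=set0).
Proof.
move=> cC Cx; have : nbhs x (~` C) by exact: (open_nbhs_nbhs (conj (closed_openC cC) Cx)).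
move=> /nbhs_ballP[e /= e0 he]; exists (e / 2); first by rewrite divr_gt0.
move=> r r0 re [y [[h1 h2] Cy]]; apply: (he y) => //.
rewrite -ball_normE /= /Num.norm /= mx_normrE.
apply/bigmax_ltP; split => // -[i j] _ /=; rewrite !mxE ord1; move: j; apply: ord2P.
  by rewrite -/(cx x) -/(cx y) ltr_norml; apply/andP; split; lra.
by rewrite -/(cy x) -/(cy y) ltr_norml; apply/andP; split; lra.
Qed.

Definition cap x u r s := sqbox x r `&` [set y | s <= dotp u (y - x)].

Lemma ccp_cap x u r s : ccp (cap x u r s).
Proof.
apply: ccpI; first exact: ccp_box.
rewrite (_ : mkset _ = [set y | (- cx u) * cx y + (- cy u) * cy y <= - s - cx u * cx x - cy u *
  cy x]).
  exact: ccl_half.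
by apply/seteqP; split => y /=; rewrite dotpE cxB cyB; lra.
Qed.

(** If [u] is not normal, some [y] in [C] lies strictly ahead of [x] in the direction [u]; a short
    step from [x] towards [y] stays in the square and fixes the admissible shifts. *)
Lemma cap_meets C x u r : ccl C -> C x -> ~ normal_cone C x u -> 0 < r ->
  exists2 d, 0 < d & forall s, 0 < s -> s <= d -> (cap x u r s `&` C) !=set0.
Proof.
move=> [_ /convex_setP vC] Cx nN r0.
have [y Cy dy] : exists2 y, C y & 0 < dotp u (y - x).
  apply: contrapT => h; apply: nN; split=> // y Cy; rewrite leNgt; apply/negP => dy.
  by apply: h; exists y.
pose t := Num.min 1 (r / (`|cx y - cx x| + `|cy y - cy x| + 1)).
have n0 : 0 < `|cx y - cx x| + `|cy y - cy x| + 1.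
  by have := normr_ge0 (cx y - cx x); have := normr_ge0 (cy y - cy x); lra.
have t0 : 0 < t by rewrite /t lt_min ltr01 divr_gt0.
have [t1 tr] : t <= 1 /\ t <= r / (`|cx y - cx x| + `|cy y - cy x| + 1).
  by rewrite /t !ge_min !lexx orbT.
move: tr; rewrite ler_pdivlMr// => tr.
exists (t * dotp u (y - x)); first exact: mulr_gt0.
move=> s s0 st; exists (t *: y + (1 - t) *: x); split; last by apply: vC => //; exact: ltW.
split.
  have h1 := normr_ge0 (cx y - cx x); have h2 := normr_ge0 (cy y - cy x).
  have : `|t * (cx y - cx x)| <= r by rewrite normrM gtr0_norm//; nra.
  have : `|t * (cy y - cy x)| <= r by rewrite normrM gtr0_norm//; nra.
  rewrite !ler_norml => /andP[a1 a2] /andP[a3 a4].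
  by split; rewrite ?cxD ?cyD ?cxZ ?cyZ; apply/andP; split; lra.
apply: le_trans st _; rewrite !dotpE !cxB !cyB !cxD !cyD !cxZ !cyZ; lra.
Qed.

Lemma monotone_admissible (Cp Cm : set_family R) : lf_family Cp -> lf_family Cm ->
  K2_monotone (pair_valuation Cp Cm) -> admissible Cm Cp.
Proof.
move=> hp hm mono x u.
pose B := sqbox x 1; have cB : ccp B by exact: ccp_box.
have hsum F : lf_family F -> \sum_(n \in indices F) (\1_(normal_cone (F n) x) u : int) =
    \sum_(n <- meeting F B) (\1_(normal_cone (F n) x) u : int).
  move=> hF; apply: meeting_sum => //; first exact: hF.2.
  move=> n _ hn; rewrite indicE memNset// => -[Cx _]; apply: hn; exists x; split => //.
  by apply: sqbox_center; exact: ler01.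
rewrite !hsum//.
have cclF F n : lf_family F -> n \in meeting F B -> ccl (F n).
  by move=> hF nF; apply: lf_ccl => //; apply: meeting_indices nF => //; exact: hF.2.
pose S := [seq Cp n | n <- meeting Cp B] ++ [seq Cm n | n <- meeting Cm B].
have cS : {in S, forall C, ccl C}.
  by move=> C; rewrite mem_cat => /orP[] /mapP[n nF ->]; exact: cclF.
(* The radius is chosen first, so that members missing [x] miss the square; the shift [s] depends on
   it. *)
have [|d d0 hd] := @all_small _ S (fun C r => ~ C x -> ~ ((sqbox x r `&` C) !=set0)).
  move=> C /cS[clC _]; have [Cx|Cx] := pselect (C x); first by exists 1.
  by have [d d0 hd] := closed_sqbox clC Cx; exists d => // r r0 rd _; exact: hd.
have {d d0 hd}[r [r0 r1 hr]] : exists r, [/\ 0 < r, r <= 1 &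
    {in S, forall C, ~ C x -> ~ ((sqbox x r `&` C) !=set0)}].
  by exists (Num.min d 1); split; [rewrite lt_min d0 ltr01|rewrite ge_min lexx orbT|
    apply: hd; [rewrite lt_min d0 ltr01|rewrite ge_min lexx]].
have [|d d0 /(_ d d0 (lexx d)) hs] := @all_small _ S
    (fun C s => C x -> ~ normal_cone C x u -> (cap x u r s `&` C) !=set0).
  move=> C /cS cC; have [Cx|Cx] := pselect (C x); last by exists 1.
  have [N|N] := pselect (normal_cone C x u); first by exists 1.
  by have [d d0 hd] := cap_meets cC Cx N r0; exists d => // s s0 sd _ _; exact: hd.
set s := d in hs; have s0 : 0 < s by [].
(* A member through [x] meets the square, and meets the cap exactly when [u] is not normal to it at
   [x]; any other member meets neither. *)
have key : {in S, forall C, (\1_(normal_cone C x) u : int) =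
    chi (sqbox x r `&` C) - chi (cap x u r s `&` C)}.
  move=> C CS; rewrite indicE.
  have capS : cap x u r s `<=` sqbox x r by move=> y [].
  have [Cx|Cx] := pselect (C x); last first.
    rewrite memNset; last by move=> [].
    rewrite !chi_eq0 ?subrr//; last exact: hr.
    by move=> [y [/capS hy Cy]]; apply: (hr C) => //; exists y.
  rewrite (@chi_neq0 _ (sqbox x r `&` C)); last first.
    by exists x; split => //; apply: sqbox_center; exact: ltW.
  have [N|N] := pselect (normal_cone C x u).
    rewrite mem_set// chi_eq0// => -[y [[_ hy] Cy]].
    by have [_ /(_ y Cy)] := N; move: hy => /=; lra.
  by rewrite memNset// chi_neq0//; exact: hs.
have cC F : lf_family F -> {subset [seq F n | n <- meeting F B] <= S} ->
   \sum_(n <- meeting F B) (\1_(normal_cone (F n) x) u : int) =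
   \sum_(n \in indices F) chi (sqbox x r `&` F n) - \sum_(n \in indices F) chi (cap x u r s `&` F
     n).
  move=> hF sub; rewrite !(meeting_chi hF.2 cB); first last.
  - by move=> y [h1 h2]; split; apply/andP; split; lra.
  - by move=> y [[h1 h2] _]; split; apply/andP; split; lra.
  rewrite -sumrB; apply: eq_big_seq => n nF; apply: key; apply: sub; exact: map_f.
rewrite !cC//; first last.
- by move=> C CF; rewrite mem_cat CF orbT.
- by move=> C CF; rewrite mem_cat CF.
have := @vl_mono _ (pair_valuation Cp Cm) (cap x u r s) (sqbox x r) mono (ccp_cap _ _ _ _)
  (ccp_box _ _ _ _).
rewrite /vl /pair_valuation !K2ofE; [|exact: ccp_box|exact: ccp_cap].
move=> /(_ (@subIsetl _ _ _)).
clear; move: (\sum_(_ \in _) _) (\sum_(_ \in _) _) (\sum_(_ \in _) _) (\sum_(_ \in _) _); lia.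
Qed.

End MonotoneAdmissible.

(** * Strongly convex functions and squared distances to convex sets *)

Section QuadraticControl.
Variable R : realType.
Local Notation V := 'rV[R]_2.
Implicit Types (A B C K L : set V) (x y z u : V) (F : V -> R) (g : V -> V).

Lemma cxN x : cx (- x) = - cx x. Proof. by rewrite /cx mxE. Qed.
Lemma cyN x : cy (- x) = - cy x. Proof. by rewrite /cy mxE. Qed.

Definition sqd x y : R := dotp (y - x) (y - x).

Lemma sqdE x y : sqd x y = (cx y - cx x) ^+ 2 + (cy y - cy x) ^+ 2.
Proof. by rewrite /sqd dotpE !cxB !cyB !expr2. Qed.

Lemma sqd_ge0 x y : 0 <= sqd x y.
Proof. by rewrite sqdE addr_ge0// sqr_ge0. Qed.

Lemma sqd_eq0 x y : sqd x y <= 0 -> y = x.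
Proof.
rewrite sqdE => h; have h1 := sqr_ge0 (cx y - cx x); have h2 := sqr_ge0 (cy y - cy x).
have /eqP : (cx y - cx x) ^+ 2 = 0 by lra.
have /eqP : (cy y - cy x) ^+ 2 = 0 by lra.
by rewrite !sqrf_eq0 !subr_eq0 => /eqP ? /eqP ?; exact: rV2_eq.
Qed.

(* [g] is the gradient of [F]; [e > 0] expresses strong convexity. *)
Definition quad_ctrl F g (e a : R) :=
  (forall x y, F x + dotp (g x) (y - x) + e * sqd x y <= F y) /\
  (forall x y, F y <= F x + dotp (g x) (y - x) + a * sqd x y).

Lemma quad_ctrlD F g e a F' g' e' a' : quad_ctrl F g e a -> quad_ctrl F' g' e' a' ->
  quad_ctrl (fun x => F x + F' x) (fun x => g x + g' x) (e + e') (a + a').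
Proof.
move=> [h1 h2] [h3 h4]; split=> x y.
  have := h1 x y; have := h3 x y; rewrite !dotpE !cxB !cyB !cxD !cyD; lra.
have := h2 x y; have := h4 x y; rewrite !dotpE !cxB !cyB !cxD !cyD; lra.
Qed.

Lemma quad_ctrlZ k F g e a : 0 <= k -> quad_ctrl F g e a ->
  quad_ctrl (fun x => k * F x) (fun x => k *: g x) (k * e) (k * a).
Proof.
move=> k0 [h1 h2]; split=> x y.
  have := ler_wpM2l k0 (h1 x y); rewrite !dotpE cxZ cyZ; lra.
have := ler_wpM2l k0 (h2 x y); rewrite !dotpE cxZ cyZ; lra.
Qed.

Lemma quad_ctrl_sqd z : quad_ctrl (sqd z) (fun x => 2 *: (x - z)) 1 1.
Proof. by split=> x y; rewrite !sqdE dotpE !cxZ !cyZ !cxB !cyB !expr2; lra. Qed.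

Lemma cvg_quad x u (k c : R) : c + dotp u (y - x) + k * sqd x y @[y --> x] --> c.
Proof.
have h1 : cx y - cx x @[y --> x] --> cx x - cx x.
  exact: (cvgB (@continuous_cx R x) (cvg_cst _)).
have h2 : cy y - cy x @[y --> x] --> cy x - cy x.
  exact: (cvgB (@continuous_cy R x) (cvg_cst _)).
have h3 := cvgD (cvgD (cvg_cst c) (cvgD (cvgM (cvg_cst (cx u)) h1) (cvgM (cvg_cst (cy u)) h2)))
   (cvgM (cvg_cst k) (cvgD (cvgM h1 h1) (cvgM h2 h2))).
have E : (fun y => c + dotp u (y - x) + k * sqd x y) = (fun y => c +
    (cx u * (cx y - cx x) + cy u * (cy y - cy x)) + k *
    ((cx y - cx x) * (cx y - cx x) + (cy y - cy x) * (cy y - cy x))).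
  by apply/funext => y; rewrite sqdE dotpE cxB cyB !expr2.
rewrite E; move: h3; rewrite !subrr !mulr0 !addr0 mulr0 addr0; exact.
Qed.

Lemma quad_ctrl_continuous F g e a : quad_ctrl F g e a -> continuous F.
Proof.
move=> [h1 h2] x.
have hb : \forall y \near x, F x + dotp (g x) (y - x) + e * sqd x y <= F y <=
    F x + dotp (g x) (y - x) + a * sqd x y.
  by apply: (@filterE _ (nbhs x)) => y; rewrite h1 h2.
exact: (squeeze_cvgr hb (@cvg_quad x (g x) e (F x)) (@cvg_quad x (g x) a (F x))).
Qed.

Lemma compact_min F A : continuous F -> compact A -> A !=set0 ->
  exists2 x, A x & forall y, A y -> F x <= F y.
Proof.
move=> cF cA A0; have [c /set_mem Ac h] := compact_EVT_min A0 cA (continuous_subspaceT cF).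
by exists c => // y Ay; apply: h; exact: mem_set.
Qed.

Lemma small_slope (p q : R) : (forall t, 0 < t -> t <= 1 -> 0 <= p + t * q) -> 0 <= p.
Proof.
move=> h; rewrite leNgt; apply/negP => p0.
have n0 : 0 < `|q| + 1 by have := normr_ge0 q; lra.
pose t := Num.min 1 (- p / (`|q| + 1) / 2).
have t0 : 0 < t by rewrite /t lt_min ltr01 divr_gt0// divr_gt0//; lra.
have [t1 t2] : t <= 1 /\ t <= - p / (`|q| + 1) / 2 by rewrite /t !ge_min !lexx orbT.
have t3 : t * (`|q| + 1) <= - p / 2.
  by move: t2; rewrite mulrAC ler_pdivlMr.
have := h t t0 t1; have : t * q <= t * `|q| by rewrite ler_wpM2l ?ler_norm// ltW.
lra.
Qed.

(** Minimality along the segment from [x] to [y], with the upper quadratic bound, leaves a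
    first-order term that must be nonnegative as the step tends to 0. *)
Lemma minimiser_normal F g e a C x : quad_ctrl F g e a -> ccl C -> C x ->
  (forall y, C y -> F x <= F y) -> normal_cone C x (- g x).
Proof.
move=> [_ h2] [_ /convex_setP vC] Cx hx; split => // y Cy.
rewrite -oppr_ge0; apply: (@small_slope _ (a * sqd x y)) => t t0 t1.
have Cz : C (t *: y + (1 - t) *: x) by apply: vC => //; exact: ltW.
have := le_trans (hx _ Cz) (h2 x _).
rewrite !sqdE !dotpE !cxB !cyB !cxD !cyD !cxZ !cyZ !cxN !cyN !expr2 => h.
by rewrite -(pmulr_rge0 _ t0); lra.
Qed.

Lemma normal_minimiser F g e a C x y : quad_ctrl F g e a -> normal_cone C x (- g x) ->
  C y -> F x + e * sqd x y <= F y.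
Proof.
move=> [h1 _] [Cx hx] Cy; have := h1 x y; have := hx y Cy.
rewrite !dotpE !cxN !cyN; lra.
Qed.

Lemma coord_le_sq (a r : R) : 0 <= r -> a ^+ 2 <= r -> - (r + 1) <= a <= r + 1.
Proof. by move=> r0; rewrite expr2 => h; apply/andP; split; nra. Qed.

Lemma quad_ctrl_min F g e a C : 0 < e -> quad_ctrl F g e a -> ccl C -> C !=set0 ->
  exists2 x, C x & forall y, C y -> F x <= F y.
Proof.
move=> e0 hF cC [c Cc].
(* Beyond distance [r] from [c] the quadratic growth outweighs the gradient at [c], so minimising
   over a square suffices. *)
pose r := (`|cx (g c)| + `|cy (g c)| + 1) / e.
have n1 := normr_ge0 (cx (g c)); have n2 := normr_ge0 (cy (g c)).
have r0 : 0 < r by apply: divr_gt0 => //; lra.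
have re : r * e = `|cx (g c)| + `|cy (g c)| + 1 by rewrite /r mulfVK// gt_eqF.
have far y : ~ sqbox c (2 * r) y -> F c <= F y.
  move=> hy; have := hF.1 c y; rewrite sqdE dotpE cxB cyB.
  set v1 := cx y - cx c; set v2 := cy y - cy c => hF1.
  pose m := Num.max `|v1| `|v2|.
  have [m1 m2] : `|v1| <= m /\ `|v2| <= m by rewrite /m !le_max !lexx orbT.
  have mr : 2 * r < m.
    rewrite ltNge; apply/negP => mr; apply: hy.
    have : `|v1| <= 2 * r by lra.
    have : `|v2| <= 2 * r by lra.
    by rewrite !ler_norml /v1 /v2 => /andP[? ?] /andP[? ?]; split; apply/andP; split; lra.
  have p1 : - (`|cx (g c)| * m) <= cx (g c) * v1.
    have : `|cx (g c) * v1| <= `|cx (g c)| * m by rewrite normrM ler_wpM2l.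
    by rewrite ler_norml => /andP[].
  have p2 : - (`|cy (g c)| * m) <= cy (g c) * v2.
    have : `|cy (g c) * v2| <= `|cy (g c)| * m by rewrite normrM ler_wpM2l.
    by rewrite ler_norml => /andP[].
  have mm : m ^+ 2 <= v1 ^+ 2 + v2 ^+ 2.
    rewrite /m -(real_normK (num_real v1)) -(real_normK (num_real v2)).
    have [h|h] := leP `|v1| `|v2|; rewrite ?lerDl ?lerDr; exact: sqr_ge0.
  have m0 : 0 < m by lra.
  have em : r * e * m <= e * m ^+ 2.
    by rewrite expr2 mulrC [r * e]mulrC mulrCA; rewrite ler_pM2l// ler_pM2l//; lra.
  have e2 : e * m ^+ 2 <= e * (v1 ^+ 2 + v2 ^+ 2) by rewrite ler_pM2l.
  rewrite re in em; nra.
have cB : ccp (C `&` sqbox c (2 * r)) by rewrite setIC; apply: ccpI => //; exact: ccp_box.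
have Bc : sqbox c (2 * r) c by apply: sqbox_center; lra.
have [|x [Cx Bx] hx] := @compact_min F _ (quad_ctrl_continuous hF) cB.1.
  by exists c.
exists x => // y Cy; have [By|By] := pselect (sqbox c (2 * r) y); first exact: hx.
by apply: le_trans (far y By); exact: hx.
Qed.

Section Distance.
Variable K : set V.
Hypotheses (cK : ccp K) (K0 : K !=set0).

Lemma nearest_exists y : exists p, K p /\ forall k, K k -> dotp (y - p) (k - p) <= 0.
Proof.
have [p Kp hp] := quad_ctrl_min ltr01 (quad_ctrl_sqd y) (ccp_ccl cK) K0.
exists p; split=> // k Kk.
have [_ /(_ k Kk)] := minimiser_normal (quad_ctrl_sqd y) (ccp_ccl cK) Kp hp.
rewrite !dotpE !cxN !cyN !cxZ !cyZ !cxB !cyB; lra.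
Qed.

Definition nearest y := projT1 (cid (nearest_exists y)).

Lemma nearest_in y : K (nearest y).
Proof. by rewrite /nearest; case: cid => p []. Qed.

Lemma nearest_obtuse y k : K k -> dotp (y - nearest y) (k - nearest y) <= 0.
Proof. by rewrite /nearest; case: cid => p [_] /= h Kk; exact: h. Qed.

Definition dist2 y := sqd (nearest y) y.

Lemma dist2_ge0 y : 0 <= dist2 y. Proof. exact: sqd_ge0. Qed.

Lemma dist2_le y k : K k -> dist2 y <= sqd k y.
Proof.
move=> Kk; have := nearest_obtuse y Kk; rewrite /dist2 !sqdE !dotpE !cxB !cyB.
have := sqr_ge0 (cx k - cx (nearest y)); have := sqr_ge0 (cy k - cy (nearest y)).
rewrite !expr2; lra.
Qed.

Lemma dist2_in y : K y -> dist2 y = 0.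
Proof.
move=> Ky; apply/eqP; rewrite eq_le dist2_ge0 andbT; apply: le_trans (dist2_le y Ky) _.
by rewrite sqdE !subrr expr0n addr0.
Qed.

Lemma dist2_le0 y : dist2 y <= 0 -> K y.
Proof. by move=> /sqd_eq0 ->; exact: nearest_in. Qed.

(** Upper bound: [nearest x] competes for the distance of [y]. Lower bound: the obtuse angle at
    [nearest x], plus the square of the difference of the two vectors to the nearest points. *)
Lemma quad_ctrl_dist2 : quad_ctrl dist2 (fun x => 2 *: (x - nearest x)) 0 1.
Proof.
split=> x y; last first.
  apply: le_trans (dist2_le y (nearest_in x)) _.
  rewrite /dist2 !sqdE !dotpE !cxZ !cyZ !cxB !cyB; lra.
have := nearest_obtuse x (nearest_in y).
rewrite /dist2 !sqdE !dotpE !cxZ !cyZ !cxB !cyB mul0r.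
set a := cx (nearest x); set b := cy (nearest x).
set a' := cx (nearest y); set b' := cy (nearest y).
have := sqr_ge0 (cx y - a' - (cx x - a)); have := sqr_ge0 (cy y - b' - (cy x - b)).
rewrite !expr2; lra.
Qed.

Lemma dist2_box r : K `<=` box (- r) r (- r) r -> forall (d : R), 0 <= d ->
  exists2 s, 0 < s & forall y, dist2 y <= d -> box (- s) s (- s) s y.
Proof.
move=> Kr d d0; exists (`|r| + d + 1); first by have := normr_ge0 r; lra.
move=> y; rewrite /dist2 sqdE => h.
have [/andP[h1 h2] /andP[h3 h4]] := Kr _ (nearest_in y).
have q1 := sqr_ge0 (cx y - cx (nearest y)); have q2 := sqr_ge0 (cy y - cy (nearest y)).
have /andP[h5 h6] : - (d + 1) <= cx y - cx (nearest y) <= d + 1 by apply: coord_le_sq; lra.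
have /andP[h7 h8] : - (d + 1) <= cy y - cy (nearest y) <= d + 1 by apply: coord_le_sq; lra.
have rr := ler_norm r; split; apply/andP; split; lra.
Qed.

Lemma dist2_positive C : ccl C -> ~ ((K `&` C) !=set0) ->
  exists2 d, 0 < d & forall y, C y -> d <= dist2 y.
Proof.
move=> cC hn; have [r [_ Kr]] := box_bounded cK.1.
have [s s0 hs] := dist2_box Kr ler01.
have cB : ccp (box (- s) s (- s) s `&` C) by apply: ccpI => //; exact: ccp_box.
have [B0|B0] := pselect ((box (- s) s (- s) s `&` C) !=set0); last first.
  exists 1 => // y Cy; rewrite leNgt; apply/negP => /ltW /hs hy; apply: B0; by exists y.
have [x [_ Cx] hx] := compact_min (quad_ctrl_continuous quad_ctrl_dist2) cB.1 B0.
exists (Num.min 1 (dist2 x)).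
  rewrite lt_min ltr01 /= ltNge; apply/negP => /dist2_le0 Kx; apply: hn; by exists x.
move=> y Cy; rewrite ge_min.
have [//|/ltW /hs hy] := leP 1 (dist2 y).
by rewrite hx ?orbT.
Qed.

End Distance.
End QuadraticControl.

Section AdmissibleMonotone.
Variable R : realType.
Local Notation V := 'rV[R]_2.
Implicit Types (A B C K L : set V) (x y u : V).

Lemma sum_uniq_eq (T : eqType) (s : seq T) (a : T) : uniq s ->
  \sum_(x <- s) ((x == a)%:R : int) = (a \in s)%:R.
Proof.
elim: s => [|x s IH] /=; first by rewrite big_nil.
move=> /andP[xs us]; rewrite big_cons IH// inE eq_sym.
by case: eqVneq => [->|_]; rewrite ?(negPf xs) ?addr0 ?add0r.
Qed.

(* By strong convexity the minimiser of [F] on [C] is the only point of [C] at which [- g] is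
   normal to [C]. *)
Lemma sum_normal_cones F g e a C (Xs : seq V) x : 0 < e -> quad_ctrl F g e a -> ccl C ->
  C x -> (forall y, C y -> F x <= F y) -> uniq Xs ->
  \sum_(z <- Xs) (\1_(normal_cone C z) (- g z) : int) = (x \in Xs)%:R.
Proof.
move=> e0 hF cC Cx hx uX; rewrite -sum_uniq_eq//; apply: eq_bigr => z _.
rewrite indicE; congr (_%:R); congr nat_of_bool; apply/idP/eqP => [/set_mem N|->].
  have := normal_minimiser hF N Cx; have [Cz _] := N; have := hx z Cz => h1 h2.
  by apply/esym/sqd_eq0; rewrite -(pmulr_rle0 _ e0); lra.
by apply/mem_set; exact: (minimiser_normal hF).
Qed.

(* With [F = d(., K)^2 + M d(., L)^2 + e |.|^2], [e] small and [M] large, the minimum of [F] on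
   a set [C] of the families is below [de] iff [C] meets [K], and at most [t1] iff [C] meets
   [L]; admissibility is applied at the minimisers with values in [[de, t1]]. *)
Lemma admissible_le (Cp Cm : set_family R) K L : lf_family Cp -> lf_family Cm ->
  admissible Cm Cp -> ccp K -> ccp L -> K !=set0 -> K `<=` L ->
  vl (pair_valuation Cp Cm) K <= vl (pair_valuation Cp Cm) L.
Proof.
move=> hp hm adm cK cL K0 KL.
have L0 : L !=set0 by case: K0 => x /KL; exists x.
have [r [r0 Lr]] := box_bounded cL.1.
have Kr := subset_trans KL Lr.
(* Points of the box of half-width [r] have squared distance at most [8 * r ^+ 2]; the extra 1
   absorbs the term in [e]. *)
pose t1 : R := 8 * r ^+ 2 + 1.
have r2 : 0 <= r ^+ 2 by exact: sqr_ge0.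
have t10 : 0 <= t1 by rewrite /t1; lra.
have [b b0 hb] := dist2_box cK K0 Kr t10.
pose B := box (- b) b (- b) b; have cB : ccp B by exact: ccp_box.
have LB : L `<=` B.
  move=> y Ly; apply: hb; have [k Kk] := K0; apply: le_trans (dist2_le cK K0 y Kk) _.
  have [/andP[h1 h2] /andP[h3 h4]] := Lr y Ly; have [/andP[h5 h6] /andP[h7 h8]] := Kr k Kk.
  rewrite sqdE /t1 !expr2; nra.
have KB := subset_trans KL LB.
pose S := [seq Cp n | n <- meeting Cp B] ++ [seq Cm n | n <- meeting Cm B].
have cS : {in S, forall C, ccl C /\ C !=set0}.
  have h F n : lf_family F -> n \in meeting F B -> ccl (F n) /\ F n !=set0.
    move=> hF nF; have nI := meeting_indices hF.2 cB nF.
    by split; [exact: lf_ccl|have [] := hF.1 n nI].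
  by move=> C; rewrite mem_cat => /orP[] /mapP[n nF ->]; exact: h.
have [|de de0 /(_ de de0 (lexx _)) hde] := @all_small _ _ S (fun C d => ~ ((K `&` C) !=set0) ->
    forall y, C y -> d <= dist2 cK K0 y).
  move=> C /cS [cC _]; have [h|h] := pselect ((K `&` C) !=set0); first by exists 1.
  have [d d0 hd] := dist2_positive cK K0 cC h; exists d => // s s0 sd _ y Cy.
  exact: le_trans sd (hd y Cy).
have [|de' de'0 /(_ de' de'0 (lexx _)) hde'] := @all_small _ _ S (fun C d => ~ ((L `&` C) !=set0) ->
    forall y, C y -> d <= dist2 cL L0 y).
  move=> C /cS [cC _]; have [h|h] := pselect ((L `&` C) !=set0); first by exists 1.
  have [d d0 hd] := dist2_positive cL L0 cC h; exists d => // s s0 sd _ y Cy.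
  exact: le_trans sd (hd y Cy).
(* On [L] the term [e * sqd 0 y] is then at most 1, and at most [de / 2], so it cannot lift to the
   level [de] a set that meets [K]. *)
pose e := Num.min 1 (de / 2) / (2 * r ^+ 2 + 1).
have q0 : 0 < 2 * r ^+ 2 + 1 by lra.
have mn0 : 0 < Num.min 1 (de / 2) by rewrite lt_min ltr01 divr_gt0.
have e0 : 0 < e by apply: divr_gt0.
have [e1 e2] : e * (2 * r ^+ 2 + 1) <= 1 /\ e * (2 * r ^+ 2 + 1) <= de / 2.
  by rewrite /e mulfVK ?gt_eqF// !ge_min !lexx orbT.
(* This weight lifts above [t1] the minimum on every set that misses [L]. *)
pose M := (t1 + 1) / de'.
have M0 : 0 <= M by apply: divr_ge0; lra.
have Mde : M * de' = t1 + 1 by rewrite /M mulfVK// gt_eqF.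
pose F (y : V) := dist2 cK K0 y + M * dist2 cL L0 y + e * sqd 0 y.
pose g (x : V) := 2 *: (x - nearest cK K0 x) + M *: (2 *: (x - nearest cL L0 x)) + e *: (2 *: (x
  - 0)).
have hF : quad_ctrl F g (0 + M * 0 + e * 1) (1 + M * 1 + e * 1).
  apply: quad_ctrlD; first apply: quad_ctrlD.
  - exact: quad_ctrl_dist2.
  - by apply: quad_ctrlZ => //; exact: quad_ctrl_dist2.
  - by apply: quad_ctrlZ; [exact: ltW|exact: quad_ctrl_sqd].
have e0' : 0 < 0 + M * 0 + e * 1 by rewrite mulr0 !add0r mulr1.
have dK y := dist2_ge0 cK K0 y.
have dL y := dist2_ge0 cL L0 y.
have sq0 y : 0 <= e * sqd 0 y by apply: mulr_ge0; [exact: ltW|exact: sqd_ge0].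
have sqL y : L y -> e * sqd 0 y <= e * (2 * r ^+ 2).
  move=> Ly; rewrite ler_pM2l// sqdE; have [/andP[h1 h2] /andP[h3 h4]] := Lr y Ly.
  have -> : cx (0 : V) = 0 by rewrite /cx mxE.
  have -> : cy (0 : V) = 0 by rewrite /cy mxE.
  rewrite !subr0 !expr2; nra.
have dKL y : L y -> dist2 cK K0 y <= 8 * r ^+ 2.
  move=> Ly; have [k Kk] := K0; apply: le_trans (dist2_le cK K0 y Kk) _.
  have [/andP[h1 h2] /andP[h3 h4]] := Lr y Ly; have [/andP[h5 h6] /andP[h7 h8]] := Kr k Kk.
  rewrite sqdE !expr2; nra.
have /choice[mi hmi] : forall C, exists x, C \in S -> C x /\ forall y, C y -> F x <= F y.
  move=> C; have [CS|CS] := boolP (C \in S); last by exists 0.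
  have [cC C0] := cS C CS; have [x Cx hx] := quad_ctrl_min e0' hF cC C0.
  by exists x.
pose good x := (de <= F x) && (F x <= t1).
pose Xs := undup [seq mi C | C <- S & good (mi C)].
have XsE C : C \in S -> (mi C \in Xs) = good (mi C).
  move=> CS; rewrite mem_undup; apply/mapP/idP => [[D]|h].
    by rewrite mem_filter => /andP[h _] ->.
  by exists C => //; rewrite mem_filter h.
have goodE C : C \in S -> (good (mi C))%:R = chi (L `&` C) - chi (K `&` C).
  move=> CS; have [Cx hx] := hmi C CS; rewrite /good.
  have [[k [Kk Ck]]|hK] := pselect ((K `&` C) !=set0).
    rewrite !chi_neq0 ?subrr; [|by exists k|by exists k; split => //; exact: KL].
    have : F (mi C) <= e * (2 * r ^+ 2).
      apply: le_trans (hx k Ck) _; rewrite /F (dist2_in cK K0 Kk) (dist2_in cL L0 (KL _ Kk))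
        mulr0 !add0r.
      by apply: sqL; exact: KL.
    by move=> h; rewrite leNgt (_ : F (mi C) < de) //=; lra.
  rewrite (chi_eq0 hK) subr0.
  have h1 : de <= F (mi C).
    have := hde C CS hK _ Cx; have := sq0 (mi C); have := mulr_ge0 M0 (dL (mi C)); rewrite /F; lra.
  rewrite h1 /=; have [[k [Lk Ck]]|hL] := pselect ((L `&` C) !=set0).
    rewrite chi_neq0; last by exists k.
    have h2 : F (mi C) <= t1.
      apply: le_trans (hx k Ck) _; rewrite /F (dist2_in cL L0 Lk) mulr0 addr0 /t1.
      have := sqL k Lk; have := dKL k Lk; lra.
    by rewrite h2.
  rewrite (chi_eq0 hL) leNgt (_ : t1 < F (mi C)) //=.
  have := hde' C CS hL _ Cx; have := sq0 (mi C); have := dK (mi C) => h2 h3 h4.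
  have : M * de' <= M * dist2 cL L0 (mi C) by rewrite ler_wpM2l.
  rewrite Mde /F; lra.
have XsB x : x \in Xs -> B x.
  rewrite mem_undup => /mapP[C]; rewrite mem_filter => /andP[/andP[_ h] CS] ->.
  apply: hb; have := mulr_ge0 M0 (dL (mi C)); have := sq0 (mi C); rewrite /F in h; lra.
(* A member that meets [L] but not [K] contributes at exactly one point of [Xs], its own minimiser;
   other members contribute nowhere. As [Xs] serves both families, they can be compared point by
   point. *)
have count G : lf_family G -> {subset [seq G n | n <- meeting G B] <= S} ->
    \sum_(n \in indices G) chi (L `&` G n) - \sum_(n \in indices G) chi (K `&` G n) =
    \sum_(x <- Xs) \sum_(n \in indices G) (\1_(normal_cone (G n) x) (- g x) : int).
  move=> hG sub; rewrite (meeting_chi hG.2 cB LB) (meeting_chi hG.2 cB KB) -sumrB.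
  under [RHS]eq_big_seq => x xX.
    rewrite (@meeting_sum _ G B) //; [|exact: hG.2|]; first over.
    move=> n _ hn; rewrite indicE memNset// => -[Cx _]; apply: hn; exists x; split => //.
    exact: XsB.
  rewrite exchange_big /=; apply: eq_big_seq => n nG.
  have CS : G n \in S by apply: sub; exact: map_f.
  have [Cx hx] := hmi _ CS; have [cC _] := cS _ CS.
  by rewrite (sum_normal_cones e0' hF cC Cx hx (undup_uniq _)) XsE// goodE.
have h1 := count Cp hp; have h2 := count Cm hm.
rewrite /vl /pair_valuation !K2ofE// -subr_ge0.
rewrite [X in 0 <= X](_ : _ = (\sum_(n \in indices Cp) chi (L `&` Cp n) - \sum_(n \in indices Cp)
  chi (K `&` Cp n)) -
  (\sum_(n \in indices Cm) chi (L `&` Cm n) - \sum_(n \in indices Cm) chi (K `&` Cm n))); last by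
    ring.
rewrite h1; last by move=> C CF; rewrite mem_cat CF.
rewrite h2; last by move=> C CF; rewrite mem_cat CF orbT.
rewrite -sumrB; apply: sumr_ge0 => x _; rewrite subr_ge0; exact: adm.
Qed.

Lemma admissible_monotone (Cp Cm : set_family R) : lf_family Cp -> lf_family Cm ->
  admissible Cm Cp -> K2_monotone (pair_valuation Cp Cm).
Proof.
move=> hp hm adm K L KL; rewrite -!(vl_body (pair_valuation Cp Cm)).
have cK := ccp_body K; have cL := ccp_body L.
have [K0|K0] := pselect ((K : set V) !=set0); first exact: admissible_le.
have -> : (K : set V) = set0 by apply/seteqP; split => // x Kx; apply: K0; exists x.
rewrite vl0; last exact: pair_valuationP.
have [[x Lx]|L0] := pselect ((L : set V) !=set0); last first.
  have -> : (L : set V) = set0 by apply/seteqP; split => // x Lx; apply: L0; exists x.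
  by rewrite vl0//; exact: pair_valuationP.
(* For empty [K] compare with a point of [L]: its value is nonnegative by admissibility at [u = 0],
   a vector normal to every set at each of its points. *)
apply: (@le_trans _ _ (vl (pair_valuation Cp Cm) [set x])); last first.
  by apply: admissible_le => //; [exact: ccp_set1|exists x|move=> y ->].
rewrite pair_point /pair_indicator subr_ge0.
have E C : (\1_(normal_cone C x) 0 : int) = \1_C x.
  rewrite !indicE; congr (_%:R); congr nat_of_bool; apply/idP/idP => /set_mem.
    by move=> [Cx _]; exact: mem_set.
  move=> Cx; apply/mem_set; split => // y _; rewrite dotpE.
  have -> : cx (0 : V) = 0 by rewrite /cx mxE.
  have -> : cy (0 : V) = 0 by rewrite /cy mxE.
  by rewrite !mul0r addr0.
have := adm x 0.
rewrite [X in X <= _ -> _](eq_fsbigr (fun n => \1_(Cm n) x)); last by move=> n _; rewrite E.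
by rewrite [X in _ <= X -> _](eq_fsbigr (fun n => \1_(Cp n) x)) // => n _; rewrite E.
Qed.

End AdmissibleMonotone.

Local Open Scope card_scope.

(* Pointedness of the index type is required by [card_set_bijP]. *)
HB.instance Definition _ := isPointed.Build int 0.

(** * Assembling the local representations *)

Section Assembly.
Variable R : realType.
Local Notation V := 'rV[R]_2.
Local Notation cell := (int * int)%type.
Implicit Types (A B C : set V) (x : V) (c : cell).

Lemma family_of_index (I : set (cell * nat)) (G : cell * nat -> set V) :
  exists (F : set_family R) h, set_bij (indices F) I h /\
    forall n, F n = G (h n).
Proof.
have [/finite_setP[N IN]|inf] := pselect (finite_set I).
  have /card_set_bijP[h hh] : `I_N #= I by rewrite card_eq_sym.
  by exists (SetFamily (Some N) (fun n => G (h n))), h.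
have /card_set_bijP[h hh] : [set: nat] #= I.
  by apply/card_eqPle; split; [exact/infiniteP|exact: countableP].
by exists (SetFamily None (fun n => G (h n))), h.
Qed.

Definition cbox c : set V := box c.1%:~R (c.1 + 1)%:~R c.2%:~R (c.2 + 1)%:~R.
(** Half-open, so that the cells partition the plane; the closed [cbox] contains the representing
    sets. *)
Definition hcell c x := (c.1%:~R <= cx x < (c.1 + 1)%:~R) && (c.2%:~R <= cy x < (c.2 + 1)%:~R).

Lemma hcellE c x : hcell c x = (c == (Num.floor (cx x), Num.floor (cy x))).
Proof.
rewrite /hcell -!floor_eq; case: c => i j /=.
by rewrite xpair_eqE (eq_sym i) (eq_sym j).
Qed.

Definition cells (N : nat) : set cell := [set c | (`|c.1| <= N)%N /\ (`|c.2| <= N)%N].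

Lemma finite_cells N : finite_set (cells N).
Proof.
have fI : finite_set [set z : int | (`|z| <= N)%N].
  apply: (@sub_finite_set _ _ ((fun k : nat => k%:Z - N%:Z) @` `I_(N + N).+1)).
    move=> z /= zN; exists (absz (z + N%:Z)); lia.
  by apply: finite_image; exact: finite_II.
apply: sub_finite_set (finite_setX fI fI); by move=> [i j] [].
Qed.

Lemma bounded_cells A : compact A -> exists N, forall c, (A `&` cbox c) !=set0 -> cells N c.
Proof.
move=> /box_bounded[r [r0 Ar]]; have rN := archi_boundP (ltW r0).
exists (Num.bound r).+1 => -[i j] [x [/Ar [/andP[h1 h2] /andP[h3 h4]] [/andP[h5 h6] /andP[h7 h8]]]].
have b (z : int) y : - r <= y -> y <= r -> z%:~R <= y -> y <= (z + 1)%:~R ->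
    (`|z| <= (Num.bound r).+1)%N.
  move=> y1 y2 y3 y4.
  have : z%:~R < (Num.bound r)%:Z%:~R :> R by rewrite -pmulrn; lra.
  have : (- (Num.bound r)%:Z)%:~R < (z + 1)%:~R :> R by rewrite mulrNz -pmulrn; lra.
  by rewrite !ltr_int; move: (Num.bound r); clear=> n; lia.
by split; [exact: (b _ (cx x))|exact: (b _ (cy x))].
Qed.

Section Lists.
Variable P : cell -> seq (set V).
Hypothesis hP : forall c, {in P c, forall C, [/\ ccp C, C !=set0 & C `<=` cbox c]}.

Definition entries : set (cell * nat) := [set i | (i.2 < size (P i.1))%N].
Definition entry (i : cell * nat) : set V := nth set0 (P i.1) i.2.

Lemma entryP i : entries i -> [/\ ccp (entry i), entry i !=set0 & entry i `<=` cbox i.1].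
Proof. by move=> hi; apply: hP; exact: mem_nth. Qed.

Lemma finite_entries A : compact A -> finite_set [set i | entries i /\ (A `&` entry i) !=set0].
Proof.
move=> /bounded_cells[N hN].
apply: (@sub_finite_set _ _ (\bigcup_(c in cells N) ([set c] `*` `I_(size (P c))))).
  move=> [c k] [ik [x [Ax Ex]]]; exists c => //=.
  by have [_ _ sub] := entryP ik; apply: hN; exists x; split => //; exact: sub.
apply: bigcup_finite; first exact: finite_cells.
by move=> c _; apply: finite_setX => //; exact: finite_set1.
Qed.

Lemma list_family : exists F : set_family R, lf_family F /\
  forall N x, (forall c, cbox c x -> cells N c) ->
    \sum_(n \in indices F) (\1_(F n) x : int) =
    \sum_(c \in cells N) \sum_(C <- P c) (\1_C x : int).
Proof.
have [F [h [bij hF]]] := family_of_index entries entry.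
have [hsub hinj hsur] := bij.
exists F; split; first split.
- move=> n nF; rewrite hF; have [cC C0 _] := entryP (hsub _ nF).
  by have [? ?] := ccp_ccl cC.
- move=> K; set J := mkset _; have hJ : set_inj J h.
    by move=> n n' /set_mem[nF _] /set_mem[nF' _]; apply: hinj; exact: mem_set.
  rewrite -(eq_finite_set (inj_card_eq hJ)).
  apply: (sub_finite_set _ (finite_entries (@body_compact R K))) => _ [n [nF Kn] <-].
  by split; [exact: (hsub _ nF)|rewrite -hF].
move=> N x hN.
rewrite (eq_fsbigr (fun n => \1_(entry (h n)) x)); last by move=> n _; rewrite hF.
rewrite -(reindex_fsbig h _ _ (fun i => \1_(entry i) x : int) bij).
(* The lists have different lengths. Padding them with [set0], the default of [nth], up to the
   common length [K] turns the sum over entries into one over a finite rectangle, which splits cell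
   by cell. *)
pose K := (\max_(c <- fset_set (cells N)) size (P c))%N.
have sK c : cells N c -> (size (P c) <= K)%N.
  move=> cN; apply: (@leq_bigmax_seq _ _ xpredT) => //.
  by rewrite in_fset_set; [exact: mem_set|exact: finite_cells].
transitivity (\sum_(i \in entries `&` (cells N `*` `I_K)) (\1_(entry i) x : int)).
  apply/esym/fsbig_widen; first exact: subIsetl.
  move=> i [iE /not_andP[//|iN]] /=; rewrite indicE memNset// => Ex; apply: iN.
  have [_ _ sub] := entryP iE; have cN := hN _ (sub _ Ex).
  by split => //=; exact: leq_trans iE (sK _ cN).
transitivity (\sum_(i \in cells N `*` `I_K) (\1_(entry i) x : int)).
  apply: fsbig_widen; first exact: subIsetr.
  move=> i [iN /not_andP[iE|//]] /=; rewrite /entry nth_default ?indicE ?in_set0//.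
  by rewrite leqNgt; exact/negP.
rewrite -(@pair_fsbig _ _ _ _ _ _ _ (fun c k => \1_(entry (c, k)) x : int)) //; last exact:
  finite_cells.
apply: eq_fsbigr => c /set_mem cN.
rewrite -fsbig_ord -(big_mkord xpredT (fun k => \1_(entry (c, k)) x : int)).
rewrite (big_cat_nat (n := size (P c))) //=; last exact: sK.
rewrite [X in _ + X]big_nat_cond [X in _ + X]big1 ?addr0.
  by rewrite [RHS](big_nth set0).
by move=> k /andP[/andP[h1 _] _]; rewrite /entry nth_default ?indicE ?in_set0.
Qed.

End Lists.
End Assembly.

Section Representation.
Variable R : realType.
Local Notation V := 'rV[R]_2.
Local Notation cell := (int * int)%type.
Implicit Types (A B C : set V) (x : V) (c : cell).

Lemma mem_box x p q m M : (x \in box p q m M) = (p <= cx x <= q) && (m <= cy x <= M) :> bool.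
Proof. by apply/idP/andP => [/set_mem[]//|[h1 h2]]; apply/mem_set. Qed.

Lemma cbox_hcell x c : hcell c x -> cbox c x.
Proof. by move=> /andP[/andP[h1 h2] /andP[h3 h4]]; split; apply/andP; split => //; exact: ltW. Qed.

(** Empty intersections are dropped because members of a family must be nonempty. *)
Lemma restrict_list (P : seq (set V)) B : {in P, forall C, ccp C} -> ccl B ->
  exists P', {in P', forall C, [/\ ccp C, C !=set0 & C `<=` B]} /\
  forall x, \sum_(C <- P') (\1_C x : int) = (\sum_(C <- P) (\1_C x : int)) * \1_B x.
Proof.
move=> hP cB; exists [seq D <- [seq C `&` B | C <- P] | D != set0]; split=> [D|x].
  rewrite mem_filter => /andP[/set0P D0 /mapP[C CP E]]; split => //.
    by rewrite E; apply: ccpI => //; exact: hP.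
  by rewrite E; exact: subIsetr.
rewrite big_filter big_mkcond big_map mulr_suml; apply: eq_bigr => C _.
rewrite -indicI_mul; case: ifPn => // /negPn/eqP ->.
by rewrite indicE in_set0.
Qed.

Lemma polyconvex_nonempty (f : V -> int) B : polyconvex f -> ccl B ->
  (forall x, ~ B x -> f x = 0) ->
  exists P M, [/\ {in P, forall C, [/\ ccp C, C !=set0 & C `<=` B]},
    {in M, forall C, [/\ ccp C, C !=set0 & C `<=` B]} &
    forall x, f x = \sum_(C <- P) (\1_C x : int) - \sum_(C <- M) (\1_C x : int)].
Proof.
move=> [P [M [h E]]] cB fB.
have [|P' [hP' EP]] := @restrict_list P B _ cB.
  by move=> C CP; apply: h; rewrite mem_cat CP.
have [|M' [hM' EM]] := @restrict_list M B _ cB.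
  by move=> C CM; apply: h; rewrite mem_cat CM orbT.
exists P', M'; split => // x; rewrite EP EM -mulrBl -E indicE.
have [_|/negP xB] := boolP (x \in B); first by rewrite mulr1.
by rewrite mulr0 fB// => Bx; apply: xB; exact: mem_set.
Qed.

Section Phi.
Variable phi : K2 R -> int.
Hypotheses (hv : K2_valuation phi) (hm : K2_monotone phi) (hs : K2_sigma_continuous phi).
Local Notation fx := (fun x => vl phi [set x]).

(** The half-open cell is the closed box minus its right side and its upper side, plus their common
    corner. *)
Lemma polyconvex_hcell c : polyconvex (fun x => fx x * (hcell c x)%:R).
Proof.
have i1 (z : int) : z%:~R <= (z + 1)%:~R :> R by rewrite ler_int; lia.
pose a : R := c.1%:~R; pose a' : R := (c.1 + 1)%:~R.
pose b : R := c.2%:~R; pose b' : R := (c.2 + 1)%:~R.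
have [ab bb] : a <= a' /\ b <= b' by split; exact: i1.
have p1 := polyconvex_box hv hm hs b b' ab.
have p2 := polyconvex_box hv hm hs b b' (lexx a').
have p3 := polyconvex_box hv hm hs b' b' ab.
have p4 := polyconvex_box hv hm hs b' b' (lexx a').
apply: eq_polyconvex (polyconvexD (polyconvexB (polyconvexB p1 p2) p3) p4) => x.
rewrite !indicE !mem_box -!mulrBr -mulrDr /hcell -/a -/a' -/b -/b'; congr (_ * _).
have [h1|h1] := leP a (cx x); have [h2|h2] := leP (cx x) a';
  have [h3|h3] := leP a' (cx x); have [h4|h4] := leP b (cy x);
  have [h5|h5] := leP (cy x) b'; have [h6|h6] := leP b' (cy x);
  rewrite /= ?(addr0,add0r,subr0,addrK,subrr,addNr)//; exfalso; lra.
Qed.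

Lemma representation : exists Cp Cm : set_family R,
  [/\ lf_family Cp, lf_family Cm & forall K, phi K = pair_valuation Cp Cm K].
Proof.
have /choice[PM hPM] : forall c, exists PM : seq (set V) * seq (set V),
    [/\ {in PM.1, forall C, [/\ ccp C, C !=set0 & C `<=` cbox c]},
    {in PM.2, forall C, [/\ ccp C, C !=set0 & C `<=` cbox c]} &
    forall x, fx x * (hcell c x)%:R =
      \sum_(C <- PM.1) (\1_C x : int) - \sum_(C <- PM.2) (\1_C x : int)].
  move=> c; have [|P [M h]] := polyconvex_nonempty (polyconvex_hcell c) (@ccl_box R _ _ _ _ : ccl
    (cbox c)).
    by move=> x hx; rewrite (_ : hcell c x = false) ?mulr0//; apply/negP => /cbox_hcell.
  by exists (P, M).
have [|Cp [hp sp]] := @list_family R (fun c => (PM c).1); first by move=> c; case: (hPM c).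
have [|Cm [hm' sm]] := @list_family R (fun c => (PM c).2); first by move=> c; case: (hPM c).
exists Cp, Cm; split => //; apply: valuation_eq => //.
- exact: pair_valuationP.
- exact: pair_sigma_continuous.
move=> x; rewrite pair_point /pair_indicator.
have [N hN] := bounded_cells (@compact_set1 _ x).
have hx c : cbox c x -> cells N c by move=> h; apply: hN; exists x.
rewrite (sp N x hx) (sm N x hx).
rewrite !fsbig_finite; [|exact: finite_cells|exact: finite_cells].
rewrite -sumrB.
under eq_bigr => c _.
  have [_ _ /(_ x) <-] := hPM c; over.
rewrite -fsbig_finite; last exact: finite_cells.
pose c0 := (Num.floor (cx x), Num.floor (cy x)).
have h0 : hcell c0 x by rewrite hcellE.
rewrite -(fsbig_widen [set c0]).
- by rewrite fsbig_set1 h0 mulr1.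
- by move=> _ ->; apply: hx; exact: cbox_hcell.
- move=> c [_ /eqP hc] /=; rewrite hcellE (_ : (c == _) = false) ?mulr0//.
  by apply/negbTE.
Qed.

End Phi.

(** * Adjoining one set to a family *)

Definition cons_family (A : set V) (C : set_family R) : set_family R :=
  SetFamily (omap succn (fam_len C)) (fun n => if n is n'.+1 then C n' else A).

Lemma indices_cons A (C : set_family R) : indices (cons_family A C) = [set 0%N] `|` succn @`
  indices C.
Proof.
rewrite /indices /=; case: (fam_len C) => [N|] /=; apply/seteqP; split => -[|n] //=.
- by move=> _; left.
- by move=> nN; right; exists n.
- by case=> // -[k] //= kN [<-].
- by move=> _; left.
- by move=> _; right; exists n.
Qed.

Lemma cons_lf A (C : set_family R) : ccl A -> A !=set0 -> lf_family C -> lf_family (cons_family A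
  C).
Proof.
move=> [clA vA] A0 [h1 h2]; split.
  by move=> n; rewrite indices_cons => -[->//|[k kC <-]]; exact: h1.
move=> K; apply: (@sub_finite_set _ _ ([set 0%N] `|` succn @` [set n | indices C n /\ (K `&` C n)
  !=set0])).
  move=> n [] + hn; rewrite indices_cons => -[->|[k kC kn]]; first by left.
  by right; exists k => //; subst n.
by rewrite finite_setU; split; [exact: finite_set1|apply: finite_image; exact: h2].
Qed.

(** The last hypothesis confines the support to the finitely many members meeting [B]; a sum of
    infinite support takes the default value 0 and would not split. *)
Lemma cons_sum A (C : set_family R) (F : set V -> int) B : lf_family C -> ccp B ->
  (forall n, indices C n -> ~ ((B `&` C n) !=set0) -> F (C n) = 0) ->
  \sum_(n \in indices (cons_family A C)) F (cons_family A C n) =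
  F A + \sum_(n \in indices C) F (C n).
Proof.
move=> [_ lC] cB F0.
have fin : finite_set [set n | indices C n /\ (B `&` C n) !=set0].
  by have := lC (K2of B); rewrite K2ofE.
set J := mkset _ in fin.
rewrite indices_cons -(fsbig_widen ([set 0%N] `|` succn @` J)); first last.
- move=> n [[->|[k kC <-]] hn] /=; first by exfalso; apply: hn; left.
  by apply: F0 => // h; apply: hn; right; exists k.
- by move=> n [->|[k [kC _] <-]]; [left|right; exists k].
rewrite fsbigU0; [|exact: finite_set1|exact: finite_image|]; last by move=> n [-> [k _]].
rewrite fsbig_set1 fsbig_image; last by move=> i j _ _ [].
by congr (_ + _); apply: fsbig_widen => [n []//|n [nC hn] /=]; apply: F0 => // h; apply: hn.
Qed.

Lemma cons_admissible A (Cp Cm : set_family R) : lf_family Cp -> lf_family Cm ->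
  admissible Cm Cp -> admissible (cons_family A Cm) (cons_family A Cp).
Proof.
move=> hp hm adm x u.
have E (C : set_family R) : lf_family C -> \sum_(n \in indices (cons_family A C))
  (\1_(normal_cone (cons_family A C n) x) u : int)
   = (\1_(normal_cone A x) u : int) + \sum_(n \in indices C) (\1_(normal_cone (C n) x) u : int).
  move=> hC; apply: (@cons_sum A C (fun D => \1_(normal_cone D x) u) [set x]) => //; first exact:
    ccp_set1.
  by move=> n _ hn; rewrite indicE memNset// => -[Cx _]; apply: hn; exists x.
by rewrite !E// lerD2l.
Qed.

Lemma cons_pair_valuation A (Cp Cm : set_family R) K : lf_family Cp -> lf_family Cm ->
  pair_valuation (cons_family A Cp) (cons_family A Cm) K = pair_valuation Cp Cm K.
Proof.
move=> hp hm.
have E (C : set_family R) : lf_family C -> \sum_(n \in indices (cons_family A C)) chi (K `&`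
  cons_family A C n)
   = chi (K `&` A) + \sum_(n \in indices C) chi (K `&` C n).
  move=> hC; apply: (@cons_sum A C (fun D => chi (K `&` D)) K) => //; first exact: ccp_body.
  by move=> n _ hn; rewrite chi_eq0.
by rewrite /pair_valuation !E//; ring.
Qed.

(** A reordering preserves the number of members containing a point of [A], which is finite and
    grows by one when [A] is adjoined. *)
Lemma reordering_cons A (C : set_family R) : lf_family C -> A !=set0 ->
  ~ reordering C (cons_family A C).
Proof.
move=> hC [x Ax] [f [bij Ef]].
have Z n : indices C n -> ~ (([set x] `&` C n) !=set0) -> (\1_(C n) x : int) = 0.
  by move=> _ hn; rewrite indicE memNset// => Cx; apply: hn; exists x.
have := @cons_sum A C (fun D => \1_D x) [set x] hC (ccp_set1 x) Z.
rewrite (reindex_fsbig f _ _ _ bij) (eq_fsbigr (fun n => \1_(C n) x)); last first.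
  by move=> n /set_mem nC; rewrite Ef.
rewrite [\1_A x]indicE mem_set//= => /eqP.
by rewrite -subr_eq subrr eq_sym oner_eq0.
Qed.

End Representation.

Theorem theorem3p2 (R : realType) :
  (forall phi : K2 R -> int,
    (K2_valuation phi /\ K2_monotone phi /\ K2_sigma_continuous phi) <->
    (exists Cp Cm : set_family R,
      admissible_pair Cp Cm /\ forall K : K2 R, phi K = pair_valuation Cp Cm K))
  /\
  (forall phi : K2 R -> int,
    K2_valuation phi -> K2_monotone phi -> K2_sigma_continuous phi ->
    exists Cp Cm Dp Dm : set_family R,
      [/\ admissible_pair Cp Cm, admissible_pair Dp Dm,
          (forall K : K2 R, phi K = pair_valuation Cp Cm K),
          (forall K : K2 R, phi K = pair_valuation Dp Dm K) &
          ~ (reordering Cp Dp /\ reordering Cm Dm)])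
  /\
  (forall Cp Cm Dp Dm : set_family R,
    admissible_pair Cp Cm -> admissible_pair Dp Dm ->
    ((forall K : K2 R, pair_valuation Cp Cm K = pair_valuation Dp Dm K) <->
     (forall x : 'rV[R]_2, pair_indicator Cp Cm x = pair_indicator Dp Dm x))).
Proof.
have exist (phi : K2 R -> int) : K2_valuation phi -> K2_monotone phi ->
    K2_sigma_continuous phi -> exists Cp Cm : set_family R, [/\ lf_family Cp, lf_family Cm,
    admissible Cm Cp & forall K : K2 R, phi K = pair_valuation Cp Cm K].
  move=> hv hm hs; have [Cp [Cm [hp hm' E]]] := representation hv hm hs.
  exists Cp, Cm; split => //; apply: monotone_admissible => // K L KL.
  by rewrite -!E; exact: hm.
split; [|split].
- move=> phi; split=> [[hv [hm hs]]|[Cp [Cm [[h1 h2 h3 h4 h5] E]]]].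
    have [Cp [Cm [[h1 h2] [h3 h4] h5 E]]] := exist phi hv hm hs.
    by exists Cp, Cm.
  have -> : phi = pair_valuation Cp Cm by apply/funext.
  split; first exact: pair_valuationP.
  by split; [exact: admissible_monotone|exact: pair_sigma_continuous].
- move=> phi hv hm hs; have [Cp [Cm [hp hm' adm E]]] := exist phi hv hm hs.
  have pc := ccp_ccl (@ccp_set1 R 0); have pn : [set (0 : 'rV[R]_2)] !=set0 by exists 0.
  have [p1 p2] := cons_lf pc pn hp; have [m1 m2] := cons_lf pc pn hm'.
  exists Cp, Cm, (cons_family [set 0] Cp), (cons_family [set 0] Cm); split => //.
  + by split => //; [case: hp|case: hm'|case: hp|case: hm'].
  + by split => //; exact: cons_admissible.
  + by move=> K; rewrite cons_pair_valuation.
  + by move=> [h _]; exact: (reordering_cons hp pn h).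
- move=> Cp Cm Dp Dm [h1 h2 h3 h4 _] [g1 g2 g3 g4 _].
  exact: pair_eq.
Qed.
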